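(* Let $T$ be a left Artinian ring and $R$ be a maximal subring of $T$. Then exactly one of the following holds: (1) There exists a (unique) maximal ideal $M$ of $T$ such that $M\subseteq R$. In particular, $R/M$ is a maximal subring of the Artinian simple ring $T/M$ (which is isomorphic to $\mathbb{M}_n(D)$ for some natural number $n$ and a division ring $D$). Moreover, $(R:T)=M$ and each prime ideal of $R$ either contains $(R:T)=M$ or is a maximal ideal of $R$. (2) $R$ is a zero-dimensional ring, $Spec(R)$ is finite ($|Spec(R)|\leq |Max(T)|$), $J(R)=Nil^*(R)=Nil_*(R)=J(T)\cap R$ is a nilpotent ideal of $R$, and one of the following holds: (a) There exist maximal ideals $M\neq N$ of $T$ such that $T/M\cong T/N$ as rings. (b) $R/J(R)\cong T/J(T)$ as rings. In particular, $R$ is a semiprimary ring.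
   Context: All rings are associative and unital (not necessarily commutative), and subrings contain the identity of the big ring; ''ideal'' means two-sided ideal. A maximal subring $R$ of $T$ is a proper subring with no subring strictly between $R$ and $T$. $(R:T)=\{x\in T: TxT\subseteq R\}$ is the largest ideal of $T$ contained in $R$. $Spec$ and $Max$ denote the sets of prime and maximal (two-sided) ideals. $J$ is the Jacobson radical, $Nil_*$ the lower nilradical (intersection of all prime ideals), $Nil^*$ the upper nilradical (largest nil ideal). Zero-dimensional refers to classical Krull dimension (supremum of lengths of chains of prime ideals). A ring $R$ is semiprimary if $J(R)$ is nilpotent and $R/J(R)$ is semisimple Artinian.
   Formalization: Literally (1) and (2) can both hold (T = C×F2×F2, R = the reals×F2×F2), so ''exactly one'' is false; the formal statement adds to (2) the clause that no maximal ideal of T is contained in R. *)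

(* Defs.v *)
From HB Require Import structures.
From mathcomp Require Import all_boot all_algebra.
From mathcomp Require Import boolp classical_sets functions cardinality.

Set Implicit Arguments.
Unset Strict Implicit.
Unset Printing Implicit Defensive.

Import GRing.Theory.
Local Open Scope classical_set_scope.
Local Open Scope ring_scope.

(* Rings are [pzRingType]s (unital, associative, not necessarily commutative,
   possibly zero).  Subrings and ideals are classical sets, and are bundled
   with their closure properties only to form the rings they induce. *)

Definition is_subring (T : pzRingType) (S : set T) : Prop :=
  [/\ S 1, (forall x y, S x -> S y -> S (x - y))
    & (forall x y, S x -> S y -> S (x * y))].

Record subring (T : pzRingType) := Subring {
  subring_set :> set T;
  subring_setP : is_subring subring_set }.

Definition maximal_subring (T : pzRingType) (S : set T) : Prop :=
  [/\ is_subring S, S `<` setT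
    & forall S' : set T, is_subring S' -> ~ (S `<` S' /\ S' `<` setT)].

(* The embedding of this ring into T is [val]. *)
Definition subring_ring (T : pzRingType) (S : subring T) : Type :=
  {x : T | x \in subring_set S}.

Section SubringRing.
Variables (T : pzRingType) (S : subring T).

Lemma subring_in_closed : subring_closed [pred x | x \in subring_set S].
Proof.
have [S1 SB SM] := subring_setP S.
by split=> [|x y|x y]; rewrite !inE; [ | exact: SB | exact: SM].
Qed.

HB.instance Definition _ := SubChoice.on (subring_ring S).
HB.instance Definition _ := GRing.SubChoice_isSubPzRing.Build T
  [pred x | x \in subring_set S] (subring_ring S) subring_in_closed.
End SubringRing.

Section Ideals.
Variable R : pzRingType.
Implicit Types I J P : set R.

Definition left_ideal I : Prop :=
  [/\ I 0, (forall x y, I x -> I y -> I (x - y))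
    & (forall a x, I x -> I (a * x))].

Definition right_ideal I : Prop :=
  [/\ I 0, (forall x y, I x -> I y -> I (x - y))
    & (forall a x, I x -> I (x * a))].

Definition is_ideal I : Prop := left_ideal I /\ right_ideal I.

Definition maximal_left_ideal I : Prop :=
  [/\ left_ideal I, I `<` setT
    & forall J, left_ideal J -> ~ (I `<` J /\ J `<` setT)].

Definition maximal_ideal I : Prop :=
  [/\ is_ideal I, I `<` setT
    & forall J, is_ideal J -> ~ (I `<` J /\ J `<` setT)].

Definition ideal_mul I J : set R :=
  [set x | exists (n : nat) (a b : 'I_n -> R),
    [/\ forall i, I (a i), forall i, J (b i) & x = \sum_i a i * b i]].

Definition ideal_pow I (n : nat) : set R := iter n (ideal_mul I) setT.

Definition nilpotent_ideal I : Prop :=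
  is_ideal I /\ exists n, ideal_pow I n = [set 0].

Definition nil_ideal I : Prop :=
  is_ideal I /\ forall x, I x -> exists n : nat, x ^+ n = 0.

Definition prime_ideal P : Prop :=
  [/\ is_ideal P, P `<` setT
    & forall I J, is_ideal I -> is_ideal J ->
        ideal_mul I J `<=` P -> I `<=` P \/ J `<=` P].

End Ideals.

Definition Spec (R : pzRingType) : set (set R) := [set P | prime_ideal P].
Definition Max (R : pzRingType) : set (set R) := [set M | maximal_ideal M].

Arguments Spec R : clear implicits.
Arguments Max R : clear implicits.

Record ideal (R : pzRingType) := Ideal {
  ideal_set :> set R;
  ideal_setP : is_ideal ideal_set }.

Section Quotient.
Variables (R : pzRingType) (I : ideal R).

Definition ideal_pred : {pred R} := fun x => x \in ideal_set I.

Lemma ideal_zmod_closed : zmod_closed ideal_pred.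
Proof.
have [[I0 IB _] _] := ideal_setP I.
split=> [|x y /set_mem Ix /set_mem Iy]; first exact/mem_set.
exact/mem_set/IB.
Qed.

HB.instance Definition _ := GRing.isZmodClosed.Build R ideal_pred
  ideal_zmod_closed.

(* The additive quotient is that of the library, whose ring structure is
   restricted to commutative rings. *)
Definition quotient_ring : Type := Quotient.quot ideal_pred.

HB.instance Definition _ := GRing.Zmodule.on quotient_ring.

Local Notation pi := (\pi_(Quotient.quot ideal_pred))%qT.

Definition quotient_pi (x : R) : quotient_ring := pi x.
Let rep (x : quotient_ring) : R := repr x.

Let repK x : quotient_pi (rep x) = x. Proof. exact: reprK. Qed.

Lemma quotient_piP x y : quotient_pi x = quotient_pi y <-> ideal_set I (x - y).
Proof.
split=> [/eqP|Ixy]; first by rewrite -Quotient.idealrBE => /set_mem.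
by apply/eqP; rewrite -Quotient.idealrBE; apply/mem_set.
Qed.

Lemma quotient_pi_additive : zmod_morphism quotient_pi.
Proof. exact: pi_is_zmod_morphism. Qed.

Definition quotient_mul (x y : quotient_ring) : quotient_ring :=
  quotient_pi (rep x * rep y).

Lemma quotient_piM x y :
  quotient_pi (x * y) = quotient_mul (quotient_pi x) (quotient_pi y).
Proof.
have [[I0 IB IMl] [_ _ IMr]] := ideal_setP I.
have ID a b : ideal_set I a -> ideal_set I b -> ideal_set I (a + b).
  by move=> Ia Ib; rewrite -[b]opprK -[- b]sub0r; apply: (IB) => //; exact: IB.
apply/quotient_piP; set x' := rep _; set y' := rep _.
have -> : x * y - x' * y' = (x - x') * y + x' * (y - y').
  by rewrite mulrBl mulrBr addrA subrK.
apply: ID; [apply: IMr | apply: IMl]; apply/quotient_piP; exact/esym/repK.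
Qed.

Lemma quotient_piD x y :
  quotient_pi (x + y) = quotient_pi x + quotient_pi y.
Proof.
have pi0 : quotient_pi 0 = 0.
  by rewrite -[X in quotient_pi X](subrr 0) quotient_pi_additive subrr.
have piN z : quotient_pi (- z) = - quotient_pi z.
  by rewrite -sub0r quotient_pi_additive pi0 sub0r.
by rewrite -[y in LHS]opprK quotient_pi_additive piN opprK.
Qed.

Lemma quotient_mulA : associative quotient_mul.
Proof.
by move=> x y z; rewrite -[x]repK -[y]repK -[z]repK -!quotient_piM mulrA.
Qed.

Lemma quotient_mul1 : left_id (quotient_pi 1) quotient_mul.
Proof. by move=> x; rewrite -[x]repK -quotient_piM mul1r. Qed.

Lemma quotient_mulr1 : right_id (quotient_pi 1) quotient_mul.
Proof. by move=> x; rewrite -[x]repK -quotient_piM mulr1. Qed.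

Lemma quotient_mulDl : left_distributive quotient_mul +%R.
Proof.
move=> x y z; rewrite -[x]repK -[y]repK -[z]repK.
by rewrite -!(quotient_piM, quotient_piD) mulrDl.
Qed.

Lemma quotient_mulDr : right_distributive quotient_mul +%R.
Proof.
move=> x y z; rewrite -[x]repK -[y]repK -[z]repK.
by rewrite -!(quotient_piM, quotient_piD) mulrDr.
Qed.

HB.instance Definition _ := GRing.Zmodule_isPzRing.Build quotient_ring
  quotient_mulA quotient_mul1 quotient_mulr1 quotient_mulDl quotient_mulDr.

HB.instance Definition _ := GRing.isZmodMorphism.Build R quotient_ring
  quotient_pi quotient_pi_additive.

Lemma quotient_pi_multiplicative : monoid_morphism quotient_pi.
Proof. by split=> // x y; rewrite quotient_piM. Qed.

HB.instance Definition _ := GRing.isMonoidMorphism.Build R quotient_ring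
  quotient_pi quotient_pi_multiplicative.

End Quotient.

Definition ring_iso (A B : pzRingType) : Prop :=
  exists f : {rmorphism A -> B}, bijective f.

Section Radicals.
Variable R : pzRingType.

Definition jacobson : set R :=
  [set x | forall M, maximal_left_ideal M -> M x].

Definition lower_nilradical : set R :=
  [set x | forall P, prime_ideal P -> P x].

(* The union of all nil ideals; [upper_nilradicalP] shows that it is the
   largest of them. *)
Definition upper_nilradical : set R :=
  [set x | exists2 I, nil_ideal I & I x].

Lemma left_idealD (I : set R) : left_ideal I ->
  forall x y, I x -> I y -> I (x + y).
Proof.
move=> [I0 IB _] x y Ix Iy; rewrite -[y]opprK -[- y]sub0r.
by apply: (IB) => //; exact: IB.
Qed.

Lemma jacobson_is_ideal : is_ideal jacobson.
Proof.
have J0 : jacobson 0 by move=> M [[]].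
have JB x y : jacobson x -> jacobson y -> jacobson (x - y).
  by move=> Jx Jy M maxM; case: (maxM) => -[_ MB _] _ _; apply: MB;
    [exact: Jx | exact: Jy].
split; split=> // r x Jx M maxM.
  by case: (maxM) => -[_ _ Ml] _ _; apply: Ml; apply: Jx.
case: (maxM) => lM propM maxM'; have [M0 MB Ml] := lM.
have MD := left_idealD lM.
pose N : set R := [set z | M (z * r)].
have lN : left_ideal N.
  split=> [|u v|a u]; rewrite /N /= ?mul0r // ?mulrBl; first exact: MB.
  by rewrite -mulrA; apply: Ml.
have [N1|N1] := pselect (N 1).
  by rewrite /N /= mul1r in N1; apply: Ml.
suff maxN : maximal_left_ideal N by exact: Jx maxN.
split=> //; first by split=> // /(_ 1 I).
move=> L lL [[NL /nonsubset [y [Ly Ny]]] [_ LT]]; apply: LT => z _.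
have [L0 LB Ll] := lL; have LD := left_idealD lL.
suff L1 : L 1 by rewrite -[z]mulr1; apply: Ll.
pose K : set R := [set w | exists m s, M m /\ w = m + s * (y * r)].
have lK : left_ideal K.
  split=> [|_ _ [m [s [Mm ->]]] [m' [s' [Mm' ->]]]|a _ [m [s [Mm ->]]]].
  - by exists 0, 0; rewrite mul0r addr0.
  - exists (m - m'), (s - s'); split; first exact: MB.
    by rewrite mulrBl opprD addrACA.
  - by exists (a * m), (a * s); rewrite mulrDr mulrA; split=> //; apply: Ml.
have MK : M `<` K.
  split=> [m Mm|KM]; first by exists m, 0; rewrite mul0r addr0.
  by apply: Ny; apply: KM; exists 0, 1; rewrite mul1r add0r.
have [m [s [Mm rE]]] : K r.
  have [//|Kr] := pselect (K r).
  by case: (maxM' K lK); split=> //; split=> // /(_ r I).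
have : N (1 - s * y).
  by rewrite /N /= mulrBl mul1r {1}rE mulrA addrK.
move=> /NL L1sy; rewrite -[1](subrK (s * y)).
by apply: LD => //; apply: Ll.
Qed.

Lemma nil_idealD (I J : set R) : nil_ideal I -> nil_ideal J ->
  nil_ideal [set x | exists2 a, I a & exists2 b, J b & x = a + b].
Proof.
move=> [[[I0 IB Il] [_ _ Ir]] nilI] [[[J0 JB Jl] [_ _ Jr]] nilJ].
have JD x y : J x -> J y -> J (x + y) by exact: left_idealD.
split; first split; first split.
- by exists 0 => //; exists 0; rewrite ?addr0.
- move=> _ _ [a Ia [b Jb ->]] [a' Ia' [b' Jb' ->]].
  exists (a - a'); first exact: IB.
  by exists (b - b'); [exact: JB | rewrite opprD addrACA].
- move=> r _ [a Ia [b Jb ->]]; exists (r * a); first exact: Il.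
  by exists (r * b); [exact: Jl | rewrite mulrDr].
- split.
  + by exists 0 => //; exists 0; rewrite ?addr0.
  + move=> _ _ [a Ia [b Jb ->]] [a' Ia' [b' Jb' ->]].
    exists (a - a'); first exact: IB.
    by exists (b - b'); [exact: JB | rewrite opprD addrACA].
  + move=> r _ [a Ia [b Jb ->]]; exists (a * r); first exact: Ir.
    by exists (b * r); [exact: Jr | rewrite mulrDl].
move=> _ [a Ia [b Jb ->]].
have powJ n : exists2 c, J c & (a + b) ^+ n = a ^+ n + c.
  elim: n => [|n [c Jc IH]]; first by exists 0; rewrite ?addr0.
  exists (a * c + b * (a ^+ n + c)); last first.
    by rewrite exprS IH mulrDl mulrDr exprS addrA.
  by apply: JD; [exact: Jl | exact: Jr].
have [n an0] := nilI _ Ia; have [c Jc cE] := powJ n.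
have [m cm0] := nilJ _ Jc.
by exists (n * m)%N; rewrite exprM cE an0 add0r.
Qed.

Lemma upper_nilradicalP :
  nil_ideal upper_nilradical /\
  forall I, nil_ideal I -> I `<=` upper_nilradical.
Proof.
split; last by move=> I nilI x Ix; exists I.
have U0 : upper_nilradical 0.
  exists [set 0] => //; split; last by move=> x ->; exists 1%N; rewrite expr1.
  by split; (split=> // [x y -> ->|a x ->]); rewrite ?subr0 ?mulr0 ?mul0r.
have UB x y : upper_nilradical x -> upper_nilradical y ->
    upper_nilradical (x - y).
  move=> [I nilI Ix] [J nilJ Jy].
  exists [set z | exists2 a, I a & exists2 b, J b & z = a + b].
    exact: nil_idealD.
  exists x => //; exists (- y) => //; rewrite -sub0r.
  by case: nilJ => -[[J0 JB _] _] _; apply: JB.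
split; last by move=> x [I [_ nilI] Ix]; apply: nilI.
split; split=> // a x [I nilI Ix]; exists I => //.
  by case: nilI => -[[_ _ Il] _] _; apply: Il.
by case: nilI => -[_ [_ _ Ir]] _; apply: Ir.
Qed.

End Radicals.

Arguments jacobson R : clear implicits.
Arguments lower_nilradical R : clear implicits.
Arguments upper_nilradical R : clear implicits.

Definition Jacobson (R : pzRingType) : ideal R := Ideal (jacobson_is_ideal R).

Section RingClasses.
Variable R : pzRingType.

Definition descending_chain_condition (F : set R -> Prop) : Prop :=
  forall I : nat -> set R, (forall n, F (I n)) ->
    (forall n, I n.+1 `<=` I n) ->
    exists n, forall m, (n <= m)%N -> I m = I n.

Definition left_artinian : Prop := descending_chain_condition (@left_ideal R).
Definition right_artinian : Prop := descending_chain_condition (@right_ideal R).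
Definition artinian : Prop := left_artinian /\ right_artinian.

Definition simple_ring : Prop :=
  (1 : R) <> 0 /\
  forall I : set R, is_ideal I -> I = [set 0] \/ I = setT.

(* The regular left module is semisimple: each submodule is a direct summand. *)
Definition semisimple_ring : Prop :=
  forall I : set R, left_ideal I ->
    exists2 K : set R, left_ideal K &
      I `&` K = [set 0] /\
      forall x, exists a b, [/\ I a, K b & x = a + b].

(* Lengths count inclusions: [n.+1] primes form a chain of length [n]. *)
Definition prime_chain (n : nat) (P : nat -> set R) : Prop :=
  (forall i, (i <= n)%N -> prime_ideal (P i)) /\
  (forall i, (i < n)%N -> P i `<` P i.+1).

(* The supremum of the lengths of chains of primes is [d]; as [d] is finite,
   it is attained. *)
Definition has_krull_dim (d : nat) : Prop :=
  (exists P, prime_chain d P) /\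
  (forall n P, prime_chain n P -> (n <= d)%N).

Definition zero_dimensional : Prop := has_krull_dim 0.

End RingClasses.

Definition semiprimary (R : pzRingType) : Prop :=
  [/\ nilpotent_ideal (jacobson R),
      semisimple_ring (quotient_ring (Jacobson R))
    & artinian (quotient_ring (Jacobson R))].

Definition division_ring (D : unitRingType) : Prop :=
  forall x : D, x != 0 -> x \is a GRing.unit.

(* The ideal (R : T); T x T is contained in R as soon as the products s x t
   are, R being closed under sums. *)
Definition conductor (T : pzRingType) (R : set T) : set T :=
  [set x | forall s t, R (s * x * t)].

(* A `&` R as a subset of the ring R. *)
Definition trace (T : pzRingType) (R : subring T) (A : set T) :
    set (subring_ring R) :=
  [set x | A (val x)].

Arguments trace {T} R A : rename.

Definition exactly_one (P Q : Prop) : Prop := (P /\ ~ Q) \/ (~ P /\ Q).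

(* Main.v *)
(** If no maximal ideal M of T lies in R, maximality of R gives R + M = T, so
    R/(R & M) is isomorphic to the simple ring T/M.  As J(T) & R is nilpotent
    and is the intersection of the finitely many ideals R & M, these are all
    the primes of R.  Either two of them coincide, and then the corresponding
    simple quotients of T are isomorphic, or the Chinese remainder theorem in R
    gives R + J(T) = T and R/J(R) is isomorphic to T/J(T).  If M is contained
    in R, a prime P of R not containing M extends to the prime
    {t | M t M <= P} of T, which is maximal. *)
From HB Require Import structures.
Require Import Defs.
From mathcomp Require Import all_boot all_algebra.
From mathcomp Require Import boolp classical_sets functions cardinality.

Set Implicit Arguments.
Unset Strict Implicit.
Unset Printing Implicit Defensive.

Import GRing.Theory.
Local Open Scope classical_set_scope.
Local Open Scope ring_scope.

(** Only the left chain condition is assumed on T, whereas [artinian] and [semiprimary] are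
    two-sided notions. Minimal left ideals and complements modulo the radical give the structure of
    T: nilpotent radical, finitely many maximal ideals, every prime maximal. The right chain
    condition is recovered in each simple quotient from matrix units, and passes to T/J(T) because
    J(T) is a finite intersection of maximal ideals. No chain condition is available in R itself, so
    every fact about R has to be read off from T. If R + M = T, elements of R can replace those of T
    as multipliers modulo M, and ideals of R above the trace of M extend to ideals of T. If M lies
    in R, multiplying by M on both sides brings T into R, which is why the extension of a prime
    involves M twice. *)

(** * Calculus of one-sided and two-sided ideals, maximal and prime ideals *)

Section IdealCalculus.
Variable R : pzRingType.
Implicit Types (I J K L M P : set R) (x y z : R).

Definition ideal_add I J : set R :=
  [set x | exists a b, [/\ I a, J b & x = a + b]].

Lemma right_idealD I : right_ideal I -> forall x y, I x -> I y -> I (x + y).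
Proof.
move=> [I0 IB _] x y Ix Iy; rewrite -[y]opprK -[- y]sub0r.
by apply: (IB) => //; exact: IB.
Qed.

Lemma left_ideal_addl I J : left_ideal J -> I `<=` ideal_add I J.
Proof. by move=> [J0 _ _] x Ix; exists x, 0; rewrite addr0. Qed.

Lemma left_ideal_addr I J : left_ideal I -> J `<=` ideal_add I J.
Proof. by move=> [I0 _ _] x Jx; exists 0, x; rewrite add0r. Qed.

Lemma left_ideal_add I J :
  left_ideal I -> left_ideal J -> left_ideal (ideal_add I J).
Proof.
move=> [I0 IB IM] [J0 JB JM]; split.
- by exists 0, 0; rewrite addr0.
- move=> _ _ [a [b [Ia Jb ->]]] [c [d [Ic Jd ->]]].
  exists (a - c), (b - d); split; [exact: IB|exact: JB|].
  by rewrite opprD addrACA.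
- move=> r _ [a [b [Ia Jb ->]]]; exists (r * a), (r * b).
  by split; [exact: IM|exact: JM|rewrite mulrDr].
Qed.

Lemma right_ideal_add I J :
  right_ideal I -> right_ideal J -> right_ideal (ideal_add I J).
Proof.
move=> [I0 IB IM] [J0 JB JM]; split.
- by exists 0, 0; rewrite addr0.
- move=> _ _ [a [b [Ia Jb ->]]] [c [d [Ic Jd ->]]].
  exists (a - c), (b - d); split; [exact: IB|exact: JB|].
  by rewrite opprD addrACA.
- move=> r _ [a [b [Ia Jb ->]]]; exists (a * r), (b * r).
  by split; [exact: IM|exact: JM|rewrite mulrDl].
Qed.

Lemma is_ideal_add I J : is_ideal I -> is_ideal J -> is_ideal (ideal_add I J).
Proof.
by move=> [? ?] [? ?]; split; [exact: left_ideal_add|exact: right_ideal_add].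
Qed.

Lemma left_idealI I J : left_ideal I -> left_ideal J -> left_ideal (I `&` J).
Proof.
move=> [I0 IB IM] [J0 JB JM]; split=> // [x y [Ix Jx] [Iy Jy]|a x [Ix Jx]].
  by split; [exact: IB|exact: JB].
by split; [exact: IM|exact: JM].
Qed.

Lemma right_idealI I J : right_ideal I -> right_ideal J -> right_ideal (I `&` J).
Proof.
move=> [I0 IB IM] [J0 JB JM]; split=> // [x y [Ix Jx] [Iy Jy]|a x [Ix Jx]].
  by split; [exact: IB|exact: JB].
by split; [exact: IM|exact: JM].
Qed.

Lemma is_idealT : is_ideal [set: R].
Proof. by []. Qed.

Lemma left_ideal0 : left_ideal [set 0 : R].
Proof. by split=> // [x y -> ->|a x ->]; rewrite /= ?subr0 ?mulr0. Qed.

Lemma left_ideal1 I : left_ideal I -> I 1 -> I = setT.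
Proof.
move=> [_ _ IM] I1; apply/seteqP; split=> // x _.
by rewrite -[x]mulr1; apply: IM.
Qed.

Lemma principal_left_ideal x : left_ideal [set y | exists r, y = r * x].
Proof.
split=> [|_ _ [r ->] [s ->]|a _ [r ->]]; first by exists 0; rewrite mul0r.
  by exists (r - s); rewrite mulrBl.
by exists (a * r); rewrite mulrA.
Qed.

Lemma left_idealMr I x : left_ideal I ->
  left_ideal [set y | exists2 a, I a & y = a * x].
Proof.
move=> [I0 IB IM]; split.
- by exists 0 => //; rewrite mul0r.
- move=> _ _ [r Ir ->] [s Is ->].
  by exists (r - s); [exact: IB|rewrite mulrBl].
- by move=> a _ [r Ir ->]; exists (a * r); [exact: IM|rewrite mulrA].
Qed.

Lemma maximal_left_idealE L I : maximal_left_ideal L -> left_ideal I ->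
  L `<=` I -> ~ I `<=` L -> I = setT.
Proof.
move=> [_ _ maxL] lI LI nIL; apply: contrapT => nIT; apply: (maxL I lI).
by split; split=> // TI; apply: nIT; apply/seteqP; split.
Qed.

Lemma maximal_left_ideal_proper L : maximal_left_ideal L -> ~ L 1.
Proof. by move=> [lL [_ nTL] _] /(left_ideal1 lL) LT; apply: nTL; rewrite LT. Qed.

Lemma maximal_left_ideal_intro L : left_ideal L -> ~ L 1 ->
  (forall I, left_ideal I -> L `<=` I -> ~ I 1 -> I `<=` L) ->
  maximal_left_ideal L.
Proof.
move=> lL L1 maxL; split=> //; first by split=> // /(_ 1 I).
move=> I lI [[LI nIL] [_ nTI]]; apply: nIL; apply: maxL => // I1.
by apply: nTI; rewrite (left_ideal1 lI I1).
Qed.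

Lemma maximal_idealE M I : maximal_ideal M -> is_ideal I ->
  M `<=` I -> ~ I `<=` M -> I = setT.
Proof.
move=> [_ _ maxM] iI MI nIM; apply: contrapT => nIT; apply: (maxM I iI).
by split; split=> // TI; apply: nIT; apply/seteqP; split.
Qed.

Lemma maximal_ideal_proper M : maximal_ideal M -> ~ M 1.
Proof.
by move=> [[lM _] [_ nTM] _] /(left_ideal1 lM) MT; apply: nTM; rewrite MT.
Qed.

Lemma maximal_ideal_intro M : is_ideal M -> ~ M 1 ->
  (forall I, is_ideal I -> M `<=` I -> ~ I `<=` M -> I 1) ->
  maximal_ideal M.
Proof.
move=> iM M1 maxM; split=> //; first by split=> // /(_ 1 I).
move=> I iI [[MI nIM] [_ nTI]].
by apply: nTI; rewrite (left_ideal1 iI.1 (maxM _ iI MI nIM)).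
Qed.

Lemma maximal_ideal_eq M N : maximal_ideal M -> maximal_ideal N ->
  M `<=` N -> M = N.
Proof.
move=> mM mN MN; apply: contrapT => neq; have [iN _ _] := mN.
apply: (maximal_ideal_proper mN); rewrite (maximal_idealE mM iN MN) // => NM.
by apply: neq; apply/seteqP.
Qed.

Lemma maximal_ideal_comax M I : maximal_ideal M -> is_ideal I ->
  ~ I `<=` M -> exists a b, [/\ M a, I b & 1 = a + b].
Proof.
move=> mM iI nIM; have [iM _ _] := mM.
suff : ideal_add M I 1 by [].
rewrite (maximal_idealE mM (is_ideal_add iM iI)) //.
  by apply: left_ideal_addl; case: iI.
by move=> /(subset_trans (left_ideal_addr (J := I) iM.1)).
Qed.

Lemma maximal_left_ideal_comax L I : maximal_left_ideal L -> left_ideal I ->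
  ~ I `<=` L -> exists a b, [/\ L a, I b & 1 = a + b].
Proof.
move=> mL lI nIL; have [lL _ _] := mL.
suff : ideal_add L I 1 by [].
rewrite (maximal_left_idealE mL (left_ideal_add lL lI)) //.
  exact: left_ideal_addl.
by move=> /(subset_trans (left_ideal_addr (J := I) lL)).
Qed.

Lemma exists_maximal_left_ideal I : left_ideal I -> ~ I 1 ->
  exists2 L, maximal_left_ideal L & I `<=` L.
Proof.
move=> lI I1.
(* Taking the union with I makes the property true of the empty set, which is the union of the empty
   chain. *)
pose P X := left_ideal (I `|` X) /\ ~ (I `|` X) 1.
have [F PF Ftot|A [[lA A1] maxA]] := @Zorn_bigcup R P.
  have pick2 x y : (I `|` \bigcup_(X in F) X) x -> (I `|` \bigcup_(X in F) X) y ->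
      (I x /\ I y) \/ exists2 X, F X & (I `|` X) x /\ (I `|` X) y.
    move=> [Ix|[X FX Xx]] [Iy|[Y FY Yy]]; first by left.
    - by right; exists Y => //; split; [left|right].
    - by right; exists X => //; split; [right|left].
    - have [XY|YX] := Ftot _ _ FX FY; right.
        by exists Y => //; split; right => //; exact: XY.
      by exists X => //; split; right => //; exact: YX.
  have up X z : F X -> (I `|` X) z -> (I `|` \bigcup_(X in F) X) z.
    by move=> FX [Iz|Xz]; [left|right; exists X].
  have [I0 IB IM] := lI; split; last first.
    by move=> [//|[X FX X1]]; apply: (PF X FX).2; right.
  split; first by left.
    move=> x y Ux Uy; have [[Ix Iy]|[X FX [Xx Xy]]] := pick2 _ _ Ux Uy.
      by left; exact: IB.
    by apply: (up X) => //; have [[_ XB _] _] := PF X FX; exact: XB.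
  move=> a x [Ix|[X FX Xx]]; first by left; exact: IM.
  apply: (up X) => //; have [[_ _ XM] _] := PF X FX; apply: XM; by right.
exists (I `|` A); last by move=> x; left.
apply: maximal_left_ideal_intro => // K lK AK K1; apply: contrapT => nKA.
have IK : I `|` K = K by apply: setUidr => x Ix; apply: AK; left.
apply: (maxA K); last by rewrite /P IK.
split; first by move=> x Ax; apply: AK; right.
by move=> KA; apply: nKA => x /KA; right.
Qed.

Lemma ideal_mul_sub I J (A : set R) : A 0 -> (forall x y, A x -> A y -> A (x + y)) ->
  (forall x y, I x -> J y -> A (x * y)) -> ideal_mul I J `<=` A.
Proof.
move=> A0 AD AM x [n [a [b [Ia Jb ->]]]].
by apply: big_ind => // i _; exact: AM.
Qed.

Lemma ideal_mul1 I J x y : I x -> J y -> ideal_mul I J (x * y).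
Proof.
move=> Ix Jy; exists 1%N, (fun=> x), (fun=> y).
by split=> //; rewrite big_ord_recl big_ord0 addr0.
Qed.

(** Outer multiplications only meet the outer factors, so I left and J right suffice. This
    generality serves for V S with V a minimal left ideal. *)
Lemma ideal_mul_is_ideal I J :
  left_ideal I -> right_ideal J -> is_ideal (ideal_mul I J).
Proof.
move=> [I0 IB IM] [J0 JB JM].
have m0 : ideal_mul I J 0 by exists 0%N, (fun=> 0), (fun=> 0); rewrite big_ord0.
have mB x y : ideal_mul I J x -> ideal_mul I J y -> ideal_mul I J (x - y).
  move=> [n [a [b [Ia Jb ->]]]] [m [c [d [Ic Jd ->]]]].
  exists (n + m)%N,
    (fun i : 'I_(n + m) =>
       match fintype.split i with inl j => a j | inr j => - c j end),
    (fun i : 'I_(n + m) =>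
       match fintype.split i with inl j => b j | inr j => d j end).
  split.
  - by move=> i; case: (fintype.split i) => j //; rewrite -sub0r; exact: IB.
  - by move=> i; case: (fintype.split i).
  rewrite big_split_ord /= -sumrN; congr (_ + _); apply: eq_bigr => i _.
    by rewrite (unsplitK (inl i)).
  by rewrite (unsplitK (inr i)) mulNr.
split; split=> // r _ [n [a [b [Ia Jb ->]]]].
  exists n, (fun i => r * a i), b; split=> // [i|]; first exact: IM.
  by rewrite mulr_sumr; apply: eq_bigr => i _; rewrite mulrA.
exists n, a, (fun i => b i * r); split=> // [i|]; first exact: JM.
by rewrite mulr_suml; apply: eq_bigr => i _; rewrite mulrA.
Qed.

Lemma ideal_pow_is_ideal I n : is_ideal I -> is_ideal (ideal_pow I n).
Proof.
move=> iI; elim: n => [|n IHn]; first exact: is_idealT.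
by case: iI => lI _; case: IHn => _ rIn; exact: ideal_mul_is_ideal.
Qed.

Lemma ideal_pow_sub_prime I P n : is_ideal I -> prime_ideal P ->
  ideal_pow I n `<=` P -> I `<=` P.
Proof.
move=> iI [iP [_ nTP] primeP]; elim: n => [//|n IHn] /primeP.
by case=> //; exact: ideal_pow_is_ideal.
Qed.

Lemma nilpotent_sub_prime I P : nilpotent_ideal I -> prime_ideal P -> I `<=` P.
Proof.
move=> [iI [n In0]] pP; apply: (@ideal_pow_sub_prime I P n) => //.
by rewrite In0 => _ ->; have [[[]]] := pP.
Qed.

Lemma expr_ideal_pow I n x : I x -> ideal_pow I n (x ^+ n).
Proof. by move=> Ix; elim: n => // n IHn; rewrite exprS; exact: ideal_mul1. Qed.

Lemma nilpotent_is_nil I : nilpotent_ideal I -> nil_ideal I.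
Proof.
move=> [iI [n In0]]; split=> // x Ix; exists n.
by have := expr_ideal_pow n Ix; rewrite In0.
Qed.

Lemma prime_idealI P I J : prime_ideal P -> is_ideal I -> is_ideal J ->
  I `&` J `<=` P -> I `<=` P \/ J `<=` P.
Proof.
move=> [iP _ primeP] iI iJ IJP; apply: primeP => //.
have [[P0 _ _] _] := iP.
apply: ideal_mul_sub => //; first exact: left_idealD iP.1.
move=> x y Ix Jy; apply: IJP; split.
  by have [_ [_ _]] := iI; apply.
by have [[_ _ +] _] := iJ; apply.
Qed.

(** If neither I nor J lies in M, then 1 = a + b = c + d with a, c in M, b in I, d in J. In (a + b)
    (c + d) every term is in M, the last one because I J is. *)
Lemma maximal_ideal_prime M : maximal_ideal M -> prime_ideal M.
Proof.
move=> mM; have [iM propM _] := mM; split=> // I J iI iJ IJM.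
apply: contrapT => /not_orP[nIM nJM].
have [a [b [Ma Ib ab]]] := maximal_ideal_comax mM iI nIM.
have [c [d [Mc Jd cd]]] := maximal_ideal_comax mM iJ nJM.
apply: (maximal_ideal_proper mM); rewrite -[1]mulr1 {1}ab cd mulrDl.
have [[_ _ Ml] [_ _ Mr]] := iM.
apply: (left_idealD iM.1); first exact: Mr.
rewrite mulrDr; apply: (left_idealD iM.1); first exact: Ml.
by apply: IJM; exact: ideal_mul1.
Qed.

(** Otherwise a maximal left ideal contains 1 - x; it also contains x, hence 1. *)
Lemma jacobson_left_inverse x : jacobson R x -> exists y, y * (1 - x) = 1.
Proof.
move=> Jx; apply: contrapT => ninv.
have [|L mL TL] := exists_maximal_left_ideal (principal_left_ideal (1 - x)).
  by move=> [r rE]; apply: ninv; exists r.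
have [lL _ _] := mL; apply: (maximal_left_ideal_proper mL).
rewrite -(subrK x 1); apply: (left_idealD lL); last exact: Jx.
by apply: TL; exists 1; rewrite mul1r.
Qed.

Lemma jacobson_cancel x y : jacobson R x -> y = x * y -> y = 0.
Proof.
move=> Jx yE; have [z zE] := jacobson_left_inverse Jx.
by rewrite -[y]mul1r -zE -mulrA mulrBl mul1r -yE subrr mulr0.
Qed.

(** The radical is defined by left ideals, M is two-sided: if 1 = a + b with a in M and b in the
    radical, then a = 1 - b is left invertible. *)
Lemma jacobson_sub_maximal M : maximal_ideal M -> jacobson R `<=` M.
Proof.
move=> mM; apply: contrapT => nJM.
have [a [b [Ma Jb ab]]] := maximal_ideal_comax mM (jacobson_is_ideal R) nJM.
have [[[_ _ Ml] _] _ _] := mM; apply: (maximal_ideal_proper mM).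
have [z <-] := jacobson_left_inverse Jb; apply: Ml.
by rewrite ab addrK.
Qed.

Lemma nilpotent_left_inverse x n : x ^+ n = 0 -> exists y, y * (1 - x) = 1.
Proof.
move=> xn0; exists (\sum_(i < n) x ^+ i).
have -> : forall m, (\sum_(i < m) x ^+ i) * (1 - x) = 1 - x ^+ m.
  elim=> [|m IHm]; first by rewrite big_ord0 mul0r expr0 subrr.
  by rewrite big_ord_recr /= mulrDl IHm mulrBr mulr1 -exprSr addrA subrK.
by rewrite xn0 subr0.
Qed.
End IdealCalculus.

(** * Left Artinian rings: radical, maximal ideals and primes *)

Section LeftArtinian.
Variable R : pzRingType.
Implicit Types (I J K L M P : set R) (x y z : R).

(** Without a minimal member, dependent choice produces a strictly descending chain. *)
Lemma left_artinian_minimal (F : set (set R)) : left_artinian R ->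
  (forall I, F I -> left_ideal I) -> (exists I, F I) ->
  exists2 I, F I & forall K, F K -> K `<=` I -> K = I.
Proof.
move=> artR Fl [I0 FI0]; apply: contrapT => nomin.
have step (X : {I | F I}) : {Y : {I | F I} | sval Y `<` sval X}.
  apply: cid; apply: contrapT => noY; apply: nomin; exists (sval X).
    exact: svalP X.
  move=> K FK KX; apply/seteqP; split=> // x Xx; apply: contrapT => nKx.
  by apply: noY; exists (exist _ K FK); split=> //= /(_ x Xx).
have [f [_ fS]] := dependent_choice step (exist _ I0 FI0).
have [|n|n fn] := artR (fun n => sval (f n)).
- by move=> n; apply: Fl; exact: svalP (f n).
- by have [] := fS n.
- by have := fS n; rewrite -(fn n.+1) //; case.
Qed.

(** [ideal_pow] adds its factors on the left; this splits off the last factor instead. *)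
Lemma ideal_powSr_sub I n (A : set R) : is_ideal I ->
  A 0 -> (forall x y, A x -> A y -> A (x + y)) ->
  (forall x y, ideal_pow I n x -> I y -> A (x * y)) -> ideal_pow I n.+1 `<=` A.
Proof.
move=> iI; elim: n A => [|n IHn] A A0 AD AM; apply: ideal_mul_sub => // x y Ix.
  move=> _; rewrite -[x * y]mul1r; apply: AM => //.
  by case: iI => _ [_ _]; apply.
move: y; apply: IHn => [|y z|y z In Iz] /=; first by rewrite mulr0.
  by rewrite mulrDr; exact: AD.
by rewrite mulrA; apply: AM => //; exact: ideal_mul1.
Qed.

(** The powers of J become stationary at some B. If B <> 0, let L be minimal among the left ideals
    with B L <> 0, say b x <> 0 with x in L. As B = B J, some c j x is nonzero, so J x still
    qualifies and equals L. Then x = k x with k in J, and [jacobson_cancel] gives x = 0. *)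
Lemma jacobson_nilpotent : left_artinian R -> nilpotent_ideal (jacobson R).
Proof.
move=> artR; have iJ := jacobson_is_ideal R; set J := jacobson R in iJ *.
have iJn n : is_ideal (ideal_pow J n) by exact: ideal_pow_is_ideal.
split=> //; have [n|n|n Jn] := artR (ideal_pow J).
- by case: (iJn n).
- have [[In0 _ InM] _] := iJn n; apply: ideal_mul_sub => //.
    exact: left_idealD (iJn n).1.
  by move=> x y _ Iy; exact: InM.
exists n; have [[B0 _ _] _] := iJn n.
pose F L := left_ideal L /\ exists x b, [/\ L x, ideal_pow J n b & b * x <> 0].
apply: contrapT => Bn0.
have [||L [lL [x [b [Lx Bb bx]]]] minL] := @left_artinian_minimal F artR.
- by move=> I [].
- exists setT; split=> //; exists 1.
  suff [b Bb bn0] : exists2 b, ideal_pow J n b & b <> 0 by exists b; rewrite mulr1.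
  apply: contrapT => noB; apply: Bn0; apply/seteqP; split=> [b Bb|_ -> //].
  by apply: contrapT => bn0; apply: noB; exists b.
have [c [j [Bc Jj cjx]]] :
    exists c j, [/\ ideal_pow J n c, J j & c * j * x <> 0].
  apply: contrapT => nocj; apply: bx.
  move: Bb; rewrite -(Jn n.+1) // => Bb.
  apply: (@ideal_powSr_sub J n [set d | d * x = 0]) Bb => //=.
  - by rewrite mul0r.
  - by move=> u v ux vx; rewrite mulrDl ux vx addr0.
  by move=> u v Bu Jv; apply: contrapT => uvx; apply: nocj; exists u, v.
have FJx : F [set y | exists2 a, J a & y = a * x].
  split; first exact: left_idealMr iJ.1.
  by exists (j * x), c; split=> //; [exists j|rewrite mulrA].
have JxL : [set y | exists2 a, J a & y = a * x] `<=` L.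
  by move=> _ [k Jk ->]; have [_ _] := lL; apply.
move: (Lx); rewrite -(minL _ FJx JxL) => -[k Jk xE].
by apply: bx; rewrite (jacobson_cancel Jk xE) mulr0.
Qed.

(* Choose K minimal with I + K = R: if I & K were larger than the radical, some
   maximal left ideal L would satisfy L + (I & K) = R, and K & L would still
   be a supplement of I. *)
Lemma jacobson_complement I : left_artinian R ->
  left_ideal I -> jacobson R `<=` I ->
  exists2 K, left_ideal K &
    [/\ jacobson R `<=` K, I `&` K `<=` jacobson R & ideal_add I K = setT].
Proof.
move=> artR lI JI; have [lJ _] := jacobson_is_ideal R.
pose F K := [/\ left_ideal K, jacobson R `<=` K & ideal_add I K = setT].
have [I' []//||K [lK JK IKT] minK] := @left_artinian_minimal F artR.
  exists setT; split=> //; apply: left_ideal1; first exact: left_ideal_add.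
  by case: lI => I0 _ _; exists 0, 1; rewrite add0r.
exists K => //; split=> // x [Ix Kx] L mL; apply: contrapT => nLx.
have [lL _ _] := mL; have [_ _ IM] := lI; have [_ KB KM] := lK.
have [a [_ [La [r ->] arx]]] := maximal_left_ideal_comax mL
  (principal_left_ideal x) (fun H => nLx (H x (ex_intro _ 1 (esym (mul1r x))))).
have FKL : F (K `&` L).
  split; first exact: left_idealI.
    by move=> y Jy; split; [exact: JK|exact: Jy].
  apply: left_ideal1; first by apply: left_ideal_add => //; exact: left_idealI.
  have : ideal_add I K 1 by rewrite IKT.
  (* From 1 = i + k and 1 = a + r x: k r x is in I because x is, while k a = k - k r x is in K
     because x is, and in L because a is. *)
  move=> [i [k [Ii Kk ik]]]; exists (i + k * (r * x)), (k * a).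
  split; last by rewrite -addrA -mulrDr [_ + a]addrC -arx mulr1.
    by apply: (left_idealD lI) => //; apply: (IM); exact: (IM).
  have kaE : k * a = k - k * (r * x).
    by rewrite -[X in X - _]mulr1 arx mulrDr addrK.
  split; last by have [_ _] := lL; apply.
  by rewrite kaE; apply: KB => //; apply: (KM); exact: (KM).
by apply: nLx; have := Kx; rewrite -(minK _ FKL) => [[]|y []].
Qed.

(** For a left ideal L, the annihilator of the module R/L, which is the largest two-sided ideal
    inside L. *)
Definition left_core L : set R := [set a | forall t, L (a * t)].

Lemma left_core_sub L : left_core L `<=` L.
Proof. by move=> x /(_ 1); rewrite mulr1. Qed.

Lemma left_core_is_ideal L : left_ideal L -> is_ideal (left_core L).
Proof.
move=> [L0 LB LM]; split; split=> [t|x y Lx Ly t|a x Lx t].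
- by rewrite mul0r.
- by rewrite mulrBl; exact: LB.
- by rewrite -mulrA; exact: LM.
- by rewrite mul0r.
- by rewrite mulrBl; exact: LB.
- by rewrite -mulrA.
Qed.

(** If a maximal left ideal L omits x, then 1 = a + r x with a in L, and x = x a + x r x lies in L
    after all. *)
Lemma jacobson_semiprime x : (forall t, jacobson R (x * t * x)) -> jacobson R x.
Proof.
move=> xJ L mL; apply: contrapT => nLx; have [lL _ _] := mL.
have [a [_ [La [r ->] arx]]] := maximal_left_ideal_comax mL
  (principal_left_ideal x) (fun H => nLx (H x (ex_intro _ 1 (esym (mul1r x))))).
apply: nLx; rewrite -[x]mulr1 arx mulrDr; apply: (left_idealD lL).
  by have [_ _] := lL; apply.
by rewrite mulrA; exact: xJ.
Qed.

(** Let B be an ideal strictly above the core and K a complement of B modulo the radical. Products k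
    b are radical, since k b t k b has the factor b t k in the intersection of B and K. Writing 1 =
    l + b with l in L gives K in L; as R = B + K, even K R is in L. So K lies in the core, hence in
    B, and B = R. *)
Lemma left_core_maximal L : left_artinian R -> maximal_left_ideal L ->
  maximal_ideal (left_core L).
Proof.
move=> artR mL; have [lL _ _] := mL; have [[_ _ Jl] [_ _ Jr]] := jacobson_is_ideal R.
have LQ := left_core_is_ideal lL.
apply: maximal_ideal_intro => // [Q1|B iB QB nBQ].
  by apply: (maximal_left_ideal_proper mL); exact: left_core_sub.
have JQ : jacobson R `<=` left_core L by move=> x Jx t; exact: (Jr).
have [K lK [JK BKJ BKT]] := jacobson_complement artR iB.1 (subset_trans JQ QB).
have [[_ _ Bl] [_ _ Br]] := iB; have [_ _ Kl] := lK.
have KB k b : K k -> B b -> jacobson R (k * b).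
  move=> Kk Bb; apply: jacobson_semiprime => t.
  have -> : k * b * t * (k * b) = k * (b * t * k) * b by rewrite !mulrA.
  by apply: (Jr); apply: (Jl); apply: BKJ; split;
    [rewrite -mulrA; exact: (Br)|exact: (Kl)].
have nBL : ~ B `<=` L.
  by move=> BL; apply: nBQ => b Bb t; apply: BL; exact: Br.
have [l [b [Ll Bb lb]]] := maximal_left_ideal_comax mL iB.1 nBL.
have KL : K `<=` L.
  move=> k Kk; rewrite -[k]mulr1 lb mulrDr; apply: (left_idealD lL).
    by have [_ _] := lL; apply.
  exact: KB Kk Bb L mL.
have KQ : K `<=` left_core L.
  move=> k Kk t; have : ideal_add B K t by rewrite BKT.
  move=> [c [d [Bc Kd ->]]]; rewrite mulrDr; apply: (left_idealD lL).
    exact: KB Kk Bc L mL.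
  by apply: KL; exact: Kl.
have : ideal_add B K 1 by rewrite BKT.
move=> [c [d [Bc Kd ->]]]; apply: (left_idealD iB.1) => //.
by apply: QB; exact: KQ.
Qed.

(** Maximal left ideals are traded for two-sided ones, whose traces on R can be controlled. *)
Lemma jacobsonE : left_artinian R ->
  jacobson R = [set x | forall M, maximal_ideal M -> M x].
Proof.
move=> artR; apply/seteqP; split=> [x Jx M mM|x Mx L mL].
  exact: jacobson_sub_maximal.
by apply: left_core_sub; apply: Mx; exact: left_core_maximal.
Qed.

Lemma exists_maximal_ideal : left_artinian R -> (1 : R) <> 0 ->
  exists M, maximal_ideal M.
Proof.
move=> artR n10; have [|L mL _] := exists_maximal_left_ideal (left_ideal0 R).
  exact: n10.
by exists (left_core L); exact: left_core_maximal.
Qed.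

Definition meet_ideals (s : seq (set R)) : set R :=
  [set x | forall M, M \in s -> M x].

Lemma meet_ideals_cons M s : meet_ideals (M :: s) = M `&` meet_ideals s.
Proof.
apply/seteqP; split=> [x Mx|x [Mx sx] N].
  by split=> [|N sN]; apply: Mx; rewrite inE ?eqxx ?sN ?orbT.
by rewrite inE => /predU1P[->//|]; exact: sx.
Qed.

Lemma meet_ideals_is_ideal s : (forall M, M \in s -> is_ideal M) ->
  is_ideal (meet_ideals s).
Proof.
move=> ids; split; split=> [M sM|x y sx sy M sM|a x sx M sM];
  have [[M0 MB Ml] [_ _ Mr]] := ids _ sM; rewrite //.
- by apply: MB; [exact: sx|exact: sy].
- by apply: Ml; exact: sx.
- by apply: MB; [exact: sx|exact: sy].
- by apply: Mr; exact: sx.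
Qed.

Lemma prime_meet_ideals P s : prime_ideal P -> (forall M, M \in s -> is_ideal M) ->
  meet_ideals s `<=` P -> exists2 M, M \in s & M `<=` P.
Proof.
move=> pP; elim: s => [|M s IHs] ids sP.
  have [[lP _] [_ nTP] _] := pP; case: nTP.
  by move=> x _; apply: sP => M; rewrite in_nil.
have iM : is_ideal M by apply: ids; rewrite mem_head.
have ids' N : N \in s -> is_ideal N by move=> sN; apply: ids; rewrite inE sN orbT.
move: sP; rewrite meet_ideals_cons.
move=> /(prime_idealI pP iM (meet_ideals_is_ideal ids'))[MP|sP].
  by exists M; rewrite ?mem_head.
by have [N sN NP] := IHs ids' sP; exists N; rewrite // inE sN orbT.
Qed.

(** A minimal finite intersection of maximal ideals lies in every maximal ideal M, since
    intersecting it with M cannot shrink it. M is prime, so it contains, and hence equals, one of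
    the listed ideals. *)
Lemma finite_maximal_ideals : left_artinian R ->
  exists s : seq (set R), forall M, (M \in s) <-> maximal_ideal M.
Proof.
move=> artR; pose F I := exists2 s : seq (set R),
  (forall M, M \in s -> maximal_ideal M) & I = meet_ideals s.
have [I [s ms ->]||_ [s ms ->] mins] := @left_artinian_minimal F artR.
- by apply: (meet_ideals_is_ideal _).1 => M /ms[].
- by exists (meet_ideals [::]), [::].
exists s => M; split=> [/ms//|mM].
have FMs : F (meet_ideals (M :: s)).
  by exists (M :: s) => // N; rewrite inE => /predU1P[->//|]; exact: ms.
have sub : meet_ideals s `<=` M.
  rewrite -(mins _ FMs) meet_ideals_cons; first by move=> x [].
  by move=> x [].
have [|N sN NM] := prime_meet_ideals (maximal_ideal_prime mM) _ sub.
  by move=> N /ms[].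
by rewrite -(maximal_ideal_eq (ms _ sN) mM NM).
Qed.

Lemma jacobson_meet_ideals s : left_artinian R ->
  (forall M, (M \in s) <-> maximal_ideal M) -> jacobson R = meet_ideals s.
Proof.
move=> artR sE; rewrite jacobsonE //.
by apply/seteqP; split=> x Mx M /sE; exact: Mx.
Qed.

Lemma left_artinian_prime_maximal P : left_artinian R -> prime_ideal P ->
  maximal_ideal P.
Proof.
move=> artR pP; have [s sE] := finite_maximal_ideals artR.
have := nilpotent_sub_prime (jacobson_nilpotent artR) pP.
rewrite (jacobson_meet_ideals artR sE) => sP.
have [|M sM MP] := prime_meet_ideals pP _ sP; first by move=> M /sE[].
have mM := (sE M).1 sM; have [iP [_ nTP] _] := pP.
suff -> : P = M by [].
apply/seteqP; split=> //; apply: contrapT => nPM.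
by apply: nTP; rewrite (maximal_idealE mM iP MP nPM).
Qed.

End LeftArtinian.

(** * The division ring eSe of an idempotent e *)

Record division_idempotent (S : pzRingType) := DivisionIdempotent {
  idem : S;
  idemM : idem * idem = idem;
  idem_neq0 : idem != 0;
  idemV : forall x, idem * x * idem != 0 -> exists y,
    (idem * y * idem) * (idem * x * idem) = idem /\
    (idem * x * idem) * (idem * y * idem) = idem }.

(** The ring eSe, with identity e instead of 1. It is therefore not a subring of S: only the
    additive structure is inherited. Bundling the properties of e in the index lets this type carry
    ring instances. *)
Definition corner (S : pzRingType) (e : division_idempotent S) : Type :=
  {x : S | idem e * x * idem e == x}.

Section Corner.
Variables (S : pzRingType) (e : division_idempotent S).

Lemma corner_zmod_closed : zmod_closed [pred x : S | idem e * x * idem e == x].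
Proof.
split=> [|x y]; rewrite !inE ?mulr0 ?mul0r // => /eqP xE /eqP yE.
by rewrite mulrBr mulrBl xE yE.
Qed.

HB.instance Definition _ := SubChoice.on (corner e).
HB.instance Definition _ := GRing.SubChoice_isSubZmodule.Build S
  [pred x : S | idem e * x * idem e == x] (corner e) corner_zmod_closed.

Lemma idemML (x : S) : idem e * (idem e * x) = idem e * x.
Proof. by rewrite mulrA idemM. Qed.
Lemma idemMR (x : S) : x * idem e * idem e = x * idem e.
Proof. by rewrite -mulrA idemM. Qed.

Fact corner_subproof (x : S) :
  idem e * (idem e * x * idem e) * idem e == idem e * x * idem e.
Proof. by rewrite !mulrA idemM idemMR. Qed.

Definition to_corner (x : S) : corner e :=
  exist (fun y => idem e * y * idem e == y) _ (corner_subproof x).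

Lemma val_to_corner x : val (to_corner x) = idem e * x * idem e. Proof. by []. Qed.

Lemma cornerE (x : corner e) : idem e * val x * idem e = val x.
Proof. exact/eqP/(valP x). Qed.

Lemma cornerL (x : corner e) : idem e * val x = val x.
Proof. by rewrite -(cornerE x) -!mulrA idemML. Qed.

Lemma cornerR (x : corner e) : val x * idem e = val x.
Proof. by rewrite -(cornerE x) idemMR. Qed.

Lemma val_cornerD (x y : corner e) : val (x + y) = val x + val y.
Proof. exact: raddfD. Qed.

Lemma val_corner0 : val (0 : corner e) = 0.
Proof. exact: raddf0. Qed.

Lemma val_corner_sum (n : nat) (F : 'I_n -> corner e) :
  val (\sum_i F i) = \sum_i val (F i).
Proof. exact: raddf_sum. Qed.

Definition corner_mul (x y : corner e) : corner e := to_corner (val x * val y).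
Definition corner_one : corner e := to_corner (idem e).

Lemma val_corner_mul x y : val (corner_mul x y) = val x * val y.
Proof. by rewrite /= mulrA cornerL -mulrA cornerR. Qed.

Lemma val_corner_one : val corner_one = idem e.
Proof. by rewrite /= !idemM. Qed.

Lemma corner_mulA : associative corner_mul.
Proof. by move=> x y z; apply: val_inj; rewrite !val_corner_mul mulrA. Qed.

Lemma corner_mul1 : left_id corner_one corner_mul.
Proof.
by move=> x; apply: val_inj; rewrite val_corner_mul val_corner_one cornerL.
Qed.

Lemma corner_mulr1 : right_id corner_one corner_mul.
Proof.
by move=> x; apply: val_inj; rewrite val_corner_mul val_corner_one cornerR.
Qed.

Lemma corner_mulDl : left_distributive corner_mul +%R.
Proof.
move=> x y z; apply: val_inj.
by rewrite val_cornerD !val_corner_mul val_cornerD mulrDl.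
Qed.

Lemma corner_mulDr : right_distributive corner_mul +%R.
Proof.
move=> x y z; apply: val_inj.
by rewrite val_cornerD !val_corner_mul val_cornerD mulrDr.
Qed.

Lemma corner_one_neq0 : corner_one != 0.
Proof.
by rewrite -val_eqE val_corner_one val_corner0 idem_neq0.
Qed.

HB.instance Definition _ := GRing.Zmodule_isNzRing.Build (corner e)
  corner_mulA corner_mul1 corner_mulr1 corner_mulDl corner_mulDr corner_one_neq0.

Lemma val_cornerM (x y : corner e) : val (x * y) = val x * val y.
Proof. exact: val_corner_mul. Qed.

Lemma val_corner1 : val (1 : corner e) = idem e.
Proof. exact: val_corner_one. Qed.

(** At 0 the inverse is set to 0 itself, because the inverse of a [unitRingType] must be the
    identity outside the units. *)
Lemma corner_inverse (x : corner e) : exists y : corner e,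
  if x == 0 then y = x else y * x = 1 /\ x * y = 1.
Proof.
case: eqP => [|/eqP xn0]; first by exists x.
have [|y [yx xy]] := @idemV S e (val x).
  by rewrite cornerE -val_corner0 val_eqE.
exists (to_corner y); split; apply: val_inj.
  by rewrite val_cornerM val_to_corner val_corner1 -[X in _ * X]cornerE.
by rewrite val_cornerM val_to_corner val_corner1 -[X in X * _]cornerE.
Qed.

Definition corner_inv (x : corner e) : corner e := sval (cid (corner_inverse x)).

Lemma corner_invP (x : corner e) :
  if x == 0 then corner_inv x = x else corner_inv x * x = 1 /\ x * corner_inv x = 1.
Proof. exact: svalP (cid (corner_inverse x)). Qed.

Lemma corner_mulVr : {in [pred x : corner e | x != 0], left_inverse 1 corner_inv *%R}.
Proof.
by move=> x; rewrite inE => /negPf x0; have := corner_invP x; rewrite x0 => -[]. Qed.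

Lemma corner_divrr : {in [pred x : corner e | x != 0], right_inverse 1 corner_inv *%R}.
Proof.
by move=> x; rewrite inE => /negPf x0; have := corner_invP x; rewrite x0 => -[]. Qed.

Lemma corner_unitP (x y : corner e) : y * x = 1 /\ x * y = 1 -> x != 0.
Proof.
move=> [yx _]; apply/eqP => x0; move: yx.
by rewrite x0 mulr0 => /esym/eqP; rewrite oner_eq0. Qed.

Lemma corner_inv_out : {in [predC [pred x : corner e | x != 0]], corner_inv =1 id}.
Proof. by move=> x; rewrite !inE negbK => x0; have := corner_invP x; rewrite x0. Qed.

HB.instance Definition _ := GRing.NzRing_hasMulInverse.Build (corner e)
  corner_mulVr corner_divrr corner_unitP corner_inv_out.

End Corner.

(** * The Wedderburn-Artin theorem for simple left Artinian rings *)

Section Wedderburn.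
Variable S : pzRingType.

(** Brauer's lemma for a minimal left ideal V. By simplicity V S = S, so 1 is a sum of v_i s_i;
    hence V V <> 0 and V = S e for an idempotent e. Each v_i is then a multiple of e. *)
Lemma simple_division_idempotent : simple_ring S -> left_artinian S ->
  exists (e : division_idempotent S) (n : nat) (a b : 'I_n -> S),
    1 = \sum_i a i * idem e * b i.
Proof.
move=> [n10 simpS] artS.
pose F L := left_ideal L /\ exists2 x : S, L x & x <> 0.
have [|| V [lV [x0 Vx0 x0n0]] minV] := @left_artinian_minimal S F artS.
- by move=> L [].
- by exists setT; split=> //; exists 1.
have [n [v [s [Vv _ vs]]]] : ideal_mul V setT 1.
  have [|->//] := simpS _ (ideal_mul_is_ideal lV (is_idealT S).2).
  have := ideal_mul1 (J := setT) Vx0 (I : setT 1).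
  by rewrite mulr1 => + V0; rewrite V0 => /x0n0.
have [V0 VB VM] := lV.
have [x [w [Vx Vw xw]]] : exists x w, [/\ V x, V w & x * w <> 0].
  apply: contrapT => noxw; apply: x0n0; rewrite -[x0]mulr1 vs mulr_sumr.
  apply: big1 => i _; rewrite mulrA.
  have [-> |n0] := pselect (x0 * v i = 0); first by rewrite mul0r.
  by case: noxw; exists x0, (v i).
have minV' L : left_ideal L -> L `<=` V -> (exists2 y, L y & y <> 0) -> L = V.
  by move=> lL LV Ln0; apply: minV.
have subV L : left_ideal L -> L `<=` V -> (exists2 y, L y & y <> 0) -> V `<=` L.
  by move=> lL LV Ln0; rewrite (minV' L lL LV Ln0).
have VwE : [set y | exists2 a, V a & y = a * w] = V.
  apply: minV'; first exact: left_idealMr.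
    by move=> _ [a Va ->]; exact: VM.
  by exists (x * w) => //; exists x.
(* From V w = V comes e in V with w = e w. Then e e - e kills w, and by minimality only 0 in V does,
   so e is idempotent. *)
move: (Vw); rewrite -{1}VwE => -[e Ve wE].
have ann y : V y -> y * w = 0 -> y = 0.
  move=> Vy yw; apply: contrapT => yn0; apply: xw.
  have -> // : x * w = 0; have [|||_] // := subV [set y | V y /\ y * w = 0] _ _ _ x Vx.
  - split=> [|y1 y2 [Vy1 y1w] [Vy2 y2w]|a y1 [Vy1 y1w]].
    + by rewrite /= mul0r.
    + by split; [exact: VB|rewrite mulrBl y1w y2w subrr].
    + by split; [exact: VM|rewrite -mulrA y1w mulr0].
  - by move=> ? [].
  - by exists y.
have eM : e * e = e.
  apply/eqP; rewrite -subr_eq0; apply/eqP; apply: ann.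
    by apply: VB => //; exact: VM.
  by rewrite mulrBl -mulrA -wE -wE subrr.
have en0 : e <> 0 by move=> e0; apply: xw; rewrite wE e0 mul0r mulr0.
have SeE y : V y -> y <> 0 -> exists t, e = t * y.
  move=> Vy yn0; have sub : [set z | exists r, z = r * y] `<=` V.
    by move=> _ [r ->]; exact: VM.
  apply: (subV _ (principal_left_ideal y) sub) => //.
  by exists y => //; exists 1; rewrite mul1r.
have linv y : e * y * e <> 0 -> exists z, e * z * e * (e * y * e) = e.
  move=> yn0; have [|t tE] := SeE _ _ yn0; first exact: VM.
  exists t; have -> : e * t * e * (e * y * e) = e * (t * (e * y * e)).
    by rewrite !mulrA -[e * t * e * e]mulrA eM.
  by rewrite -tE eM.
have division y : e * y * e != 0 -> exists z,
    e * z * e * (e * y * e) = e /\ e * y * e * (e * z * e) = e.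
  move=> /eqP yn0; have [z zy] := linv _ yn0; exists z; split=> //.
  have zn0 : e * z * e <> 0 by move=> z0; apply: en0; rewrite -zy z0 mul0r.
  have [u uz] := linv _ zn0.
  suff -> : e * y * e = e * u * e by [].
  have -> : e * y * e = e * (e * y * e) by rewrite !mulrA eM.
  by rewrite -{1}uz -mulrA zy -mulrA eM.
have [f fE] : exists f : division_idempotent S, idem f = e.
  have en0' : e != 0 by apply/eqP.
  by exists (DivisionIdempotent eM en0' division).
have vE i : exists t, v i = t * e.
  have sub : [set z | exists r, z = r * e] `<=` V.
    by move=> _ [r ->]; exact: VM.
  apply: (subV _ (principal_left_ideal e) sub) => //.
  by exists e => //; exists 1; rewrite mul1r.
have [t tE] := choice vE.
by exists f, n, t, s; rewrite vs fE; apply: eq_bigr => i _; rewrite tE.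
Qed.

(* When the number of terms in 1 = sum_i a_i e b_i is minimal, the a_i e are
   right linearly independent over the division ring eSe. *)
Lemma simple_matrix_units : simple_ring S -> left_artinian S ->
  exists (e : division_idempotent S) (n : nat) (a b : 'I_n -> S),
    [/\ (0 < n)%N, 1 = \sum_i a i * idem e * b i &
        forall i j, idem e * (b i * a j) * idem e = if i == j then idem e else 0].
Proof.
move=> simpS artS; have [e [n0 ex0]] := simple_division_idempotent simpS artS.
pose Q n := `[< exists a b : 'I_n -> S, 1 = \sum_i a i * idem e * b i >].
have exQ : exists n, Q n by exists n0; apply/asboolP.
case: (ex_minnP exQ) => n /asboolP[a [b ab]] minn {n0 ex0}.
have free (d : 'I_n -> S) k : \sum_i a i * idem e * d i * idem e = 0 ->
    idem e * d k * idem e = 0.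
  move=> ad0; apply/eqP; apply: contrapT => /negP/idemV[w [_ dw]].
  case: n a b ab d k ad0 minn dw => [|n] a b ab d k ad0 minn dw; first by case: k dw.
  suff /minn : Q n by rewrite ltnn.
  (* As e d_k e is invertible in eSe, the relation expresses a_k e by the other a_i e. Substituting
     removes the k-th term from the expression of 1, against minimality. *)
  apply/asboolP; exists (fun i => a (lift k i)),
    (fun i => b (lift k i)
       - d (lift k i) * (idem e * (idem e * w * idem e) * b k)).
  have abE : 1 = \sum_i a i * idem e *
      (b i - d i * (idem e * (idem e * w * idem e) * b k)).
    under eq_bigr do rewrite mulrBr !mulrA.
    rewrite sumrB -ab.
    transitivity (1 - (\sum_i a i * idem e * d i * idem e) *
        (idem e * w * idem e * b k)).
      by rewrite ad0 mul0r subr0.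
    by rewrite mulr_suml; congr (_ - _); apply: eq_bigr => i _; rewrite !mulrA.
  rewrite {1}abE (bigD1_ord k) //= [X in X + _](_ : _ = 0) ?add0r //.
  rewrite -mulrA mulrBr.
  suff -> : idem e * (d k * (idem e * (idem e * w * idem e) * b k))
      = idem e * b k by rewrite subrr mulr0.
  transitivity (idem e * d k * idem e * (idem e * w * idem e) * b k).
    by rewrite !mulrA.
  by rewrite dw.
exists e, n, a, b; split=> //.
  case: n a b ab {minn free} => // a b /esym; rewrite big_ord0.
  by case: simpS => n10 _ /esym /n10.
(* Independence is applied to the relation sum_i a_i e (b_i a_j - delta_ij) e = a_j e - a_j e =
   0. *)
move=> i j; have := free (fun i => b i * a j - (i == j)%:R) i.
rewrite mulrBr mulrBl => /(_ _)/eqP; rewrite subr_eq0 => /(_ _)/eqP ->.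
  by case: eqP; rewrite ?mulr1 ?idemM // mulr0 mul0r.
under eq_bigr do rewrite mulrBr mulrBl !mulrA.
rewrite sumrB -!mulr_suml -ab mul1r (bigD1 j) //= eqxx mulr1 big1.
  by rewrite addr0 idemMR subrr.
by move=> k /negPf ->; rewrite mulr0.
Qed.

(** The a_i e form a basis of S e as a right eSe-module. The map f sends s to the matrix of left
    multiplication by s in this basis. *)
Theorem simple_matrix_ring : simple_ring S -> left_artinian S ->
  exists (n : nat) (D : unitRingType),
    [/\ (0 < n)%N, division_ring D & ring_iso S 'M[D]_n].
Proof.
move=> simpS artS; have [e [n [a [b [n_gt0 ab ba]]]]] := simple_matrix_units simpS artS.
exists n, (corner e); split=> //.
pose f s : 'M[corner e]_n := \matrix_(i, j) to_corner e (b i * s * a j).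
pose g (A : 'M[corner e]_n) := \sum_i \sum_j a i * val (A i j) * b j.
have fB : zmod_morphism f.
  move=> s t; apply/matrixP => i j; rewrite !mxE; apply: val_inj.
  by rewrite raddfB !val_to_corner !(mulrBr, mulrBl).
have fM : monoid_morphism f.
  split=> [|s t]; last (change (f (s * t) = f s *m f t)).
    change (f 1 = 1%:M); apply/matrixP => i j; rewrite !mxE; apply: val_inj.
    rewrite val_to_corner mulr1 ba.
    by case: eqP => _; rewrite ?mulr1n ?val_corner1 ?mulr0n ?val_corner0.
  apply/matrixP => i j; rewrite !mxE; apply: val_inj.
  rewrite val_to_corner -[s in LHS]mulr1 ab val_corner_sum !(mulr_sumr, mulr_suml).
  apply: eq_bigr => k _; rewrite !mxE val_cornerM !val_to_corner !mulrA.
  by rewrite idemMR.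
have fK : cancel f g.
  move=> s; rewrite /g -[RHS]mulr1 -[RHS]mul1r {1}ab ab mulr_suml.
  apply: eq_bigr => i _; rewrite !mulr_sumr; apply: eq_bigr => j _.
  by rewrite mxE val_to_corner !mulrA.
have fK' : cancel g f.
  move=> A; apply/matrixP => k l; rewrite mxE; apply: val_inj.
  rewrite val_to_corner.
  transitivity (\sum_i \sum_j (idem e * (b k * a i) * idem e) * val (A i j)
      * (idem e * (b j * a l) * idem e)).
    rewrite !(mulr_sumr, mulr_suml); apply: eq_bigr => i _.
    rewrite !(mulr_sumr, mulr_suml); apply: eq_bigr => j _.
    by rewrite -(cornerE (A i j)) !mulrA !idemMR.
  rewrite (bigD1 k) //= [X in _ + X]big1 ?addr0 => [|i /negPf ik].
    rewrite (bigD1 l) //= big1 ?addr0 => [|j /negPf jl].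
      by rewrite !ba !eqxx cornerL cornerR.
    by rewrite !ba jl mulr0.
  by apply: big1 => j _; rewrite ba eq_sym ik !mul0r.
pose F : {rmorphism S -> 'M[corner e]_n} := HB.pack f
  (GRing.isZmodMorphism.Build S 'M[corner e]_n f fB)
  (GRing.isMonoidMorphism.Build S 'M[corner e]_n f fM).
by exists F; exists g.
Qed.

End Wedderburn.

(** * Descending chains of right ideals below and above a given one *)

Section ChainConditions.
Variable R : pzRingType.
Implicit Types (I J : nat -> set R) (A B : set R).

Lemma chain_sub I : (forall n, I n.+1 `<=` I n) ->
  forall m n, (n <= m)%N -> I m `<=` I n.
Proof.
move=> Idec m n /subnK <-; elim: (m - n)%N => [|k IHk] //.
exact: subset_trans (Idec _) IHk.
Qed.

(** For a right ideal A: A is an Artinian right module, said with right ideals of R only. *)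
Definition right_dcc_below A := forall I, (forall n, right_ideal (I n)) ->
  (forall n, I n.+1 `<=` I n) ->
  exists n, forall m, (n <= m)%N -> A `&` I n `<=` I m.

(** For a right ideal A: R/A is an Artinian right module, said without forming the quotient. *)
Definition right_dcc_above A := forall I, (forall n, right_ideal (I n)) ->
  (forall n, A `<=` I n) -> (forall n, I n.+1 `<=` I n) ->
  exists n, forall m, (n <= m)%N -> I n `<=` I m.

(** The hypothesis on e makes e R simple or zero, so adding a e R adds at most one composition
    factor. *)
Lemma right_dcc_below_add A (a e : R) : right_ideal A ->
  (forall c, e * c <> 0 -> exists w, e * c * w = e) ->
  right_dcc_below A ->
  right_dcc_below (ideal_add A [set x | exists c, x = a * (e * c)]).
Proof.
move=> rA emin dccA I rI Idec; have IS := chain_sub Idec.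
have [_ AB AM] := rA; have [n1 n1P] := dccA I rI Idec.
(* The coefficients c for which a e c occurs in I n modulo A: either all of R, or only elements
   killed by e. If D n is always full, the a e c part can be corrected inside I m; otherwise it
   vanishes from some index on. *)
pose D n := [set c | exists2 x, A x & I n (x + a * (e * c))].
have full n c : D n c -> e * c <> 0 -> D n = setT.
  move=> [x Ax Ix] /emin[w ew]; apply/seteqP; split=> // t _.
  exists (x * (w * t)); first exact: AM.
  have [_ _ IM] := rI n; have := IM (w * t) _ Ix.
  by rewrite mulrDl -{2}ew !mulrA.
have [Dfull|/existsNP[n2 Dn2]] := pselect (forall n, D n = setT).
  exists n1 => m n1m _ [[x [_ [Ax [c ->] ->]]] Iy].
  have [y Ay Imy] : D m c by rewrite Dfull.
  have -> : x + a * (e * c) = x - y + (y + a * (e * c)) by rewrite addrA subrK.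
  apply: (right_idealD (rI m)) => //; apply: n1P => //; split; first exact: AB.
  have [_ IB _] := rI n1; have := IB _ _ Iy (IS _ _ n1m _ Imy).
  by rewrite opprD addrACA subrr addr0.
exists (maxn n1 n2) => m /[!geq_max]/andP[n1m n2m] _ [[x [_ [Ax [c ->] ->]]] Iy].
have ec0 : e * c = 0.
  apply: contrapT => ec; apply: Dn2; apply: full ec; exists x => //.
  by apply: IS Iy; exact: leq_maxr.
move: Iy; rewrite ec0 mulr0 addr0 => Ix; apply: n1P => //; split=> //.
by apply: IS Ix; exact: leq_maxl.
Qed.

(** R modulo the intersection is an extension of R/A by a submodule of R/B. Accordingly A + I_n and
    (A & I_n) + B both become stationary, and together they force I_n to do so. *)
Lemma right_dcc_aboveI A B : right_ideal A -> right_ideal B ->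
  right_dcc_above A -> right_dcc_above B -> right_dcc_above (A `&` B).
Proof.
move=> rA rB dccA dccB I rI ABI Idec; have IS := chain_sub Idec.
have [n|n x Ax|n _ [a [b [Aa Ib ->]]]|n1 n1P] := dccA (fun n => ideal_add A (I n)).
- exact: right_ideal_add.
- by exists x, 0; have [I0 _ _] := rI n; rewrite addr0.
- by exists a, b; split=> //; exact: Idec.
have [n|n x Bx|n _ [a [b [[Aa Ia] Bb ->]]]|n2 n2P] :=
    dccB (fun n => ideal_add (A `&` I n) B).
- by apply: right_ideal_add => //; exact: right_idealI.
- by exists 0, x; have [I0 _ _] := rI n; have [A0 _ _] := rA; rewrite add0r.
- by exists a, b; split=> //; split=> //; exact: Idec.
have [_ AB AM] := rA.
exists (maxn n1 n2) => m /[!geq_max]/andP[n1m n2m].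
have AI x : A x -> I (maxn n1 n2) x -> I m x.
  move=> Ax Ix; have [|y [b [[Ay Iy] Bb xE]]] := n2P _ n2m x.
    exists x, 0; rewrite addr0; split=> //; last by case: rB.
    by split=> //; apply: IS Ix; exact: leq_maxr.
  rewrite xE; apply: (right_idealD (rI m)) => //; apply: ABI; split=> //.
  have -> : b = x - y by rewrite xE addrAC subrr add0r.
  exact: AB.
move=> x Ix; have [|a [y [Aa Iy xE]]] := n1P _ n1m x.
  exists 0, x; rewrite add0r; split=> //; first by case: rA.
  by apply: IS Ix; exact: leq_maxl.
rewrite xE; apply: (right_idealD (rI m)) => //; apply: AI => //.
have -> : a = x - y by rewrite xE addrK.
have [_ IB _] := rI (maxn n1 n2); apply: IB => //; apply: IS Iy.
by rewrite geq_max n1m.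
Qed.

End ChainConditions.

(** As 1 = sum_i a_i e b_i, S is the sum of finitely many a_i e S. Here e S is simple: if e c <> 0,
    some e c a_i e is nonzero, hence invertible in eSe. *)
Lemma simple_right_artinian (S : pzRingType) :
  simple_ring S -> left_artinian S -> right_artinian S.
Proof.
move=> simpS artS.
have [e [n [a [b [_ ab _]]]]] := simple_matrix_units simpS artS.
pose A := foldr (fun x X =>
  ideal_add X [set y : S | exists c, y = x * (idem e * c)]) [set 0].
have emin c : idem e * c <> 0 -> exists w, idem e * c * w = idem e.
  move=> ec0; have [i eca] : exists i, idem e * (c * a i) * idem e <> 0.
    apply: contrapT => noi; apply: ec0.
    rewrite -[c]mulr1 ab !mulr_sumr; apply: big1 => i _.
    have -> : idem e * (c * (a i * idem e * b i))
      = idem e * (c * a i) * idem e * b i by rewrite !mulrA.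
    suff -> : idem e * (c * a i) * idem e = 0 by rewrite mul0r.
    by apply: contrapT => n0; apply: noi; exists i.
  have [w [_ wE]] := idemV (introN eqP eca).
  by exists (a i * idem e * (idem e * w * idem e)); rewrite -[RHS]wE !mulrA.
have rA s : right_ideal (A s).
  elim: s => [|x s IHs] /=; last apply: right_ideal_add => //.
    by split=> // [x y -> ->|c x ->]; rewrite /= ?subr0 ?mul0r.
  split=> [|_ _ [c ->] [d ->]|r _ [c ->]]; first by exists 0; rewrite !mulr0.
    by exists (c - d); rewrite !mulrBr.
  by exists (c * r); rewrite !mulrA.
have dccA s : right_dcc_below (A s).
  elim: s => [|x s IHs] /=; last exact: right_dcc_below_add.
  move=> I rI _; exists 0%N => m _ x [-> _].
  by have [] := rI m.
have As s x c : x \in s -> A s (x * (idem e * c)).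
  elim: s => //= y s IHs; rewrite inE => /predU1P[->|/IHs Ax].
    exists 0, (y * (idem e * c)); rewrite add0r; split=> //; last by exists c.
    by case: (rA s).
  exists (x * (idem e * c)), 0; rewrite addr0; split=> //.
  by exists 0; rewrite !mulr0.
have AT x : A (codom a) x.
  rewrite -[x]mul1r ab mulr_suml.
  apply: big_ind => [||i _]; [by case: (rA (codom a))|exact: right_idealD|].
  by rewrite -!mulrA; apply: As; exact: codom_f.
move=> I rI Idec; have [k kP] := dccA (codom a) I rI Idec.
exists k => m km; apply/seteqP; split; first exact: (chain_sub Idec).
by move=> x Ix; apply: kP.
Qed.

(** * Transport along surjective morphisms *)

Section Surjections.
Variables (A B : pzRingType) (f : {rmorphism A -> B}).
Hypothesis f_surj : forall y, exists x, f x = y.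

Lemma left_ideal_preimage (I : set B) : left_ideal I -> left_ideal (f @^-1` I).
Proof.
move=> [I0 IB IM]; split=> [|x y Ix Iy|a x Ix]; rewrite /= ?rmorph0 ?rmorphB ?rmorphM //.
  exact: IB.
exact: IM.
Qed.

Lemma right_ideal_preimage (I : set B) : right_ideal I -> right_ideal (f @^-1` I).
Proof.
move=> [I0 IB IM]; split=> [|x y Ix Iy|a x Ix]; rewrite /= ?rmorph0 ?rmorphB ?rmorphM //.
  exact: IB.
exact: IM.
Qed.

Lemma is_ideal_preimage (I : set B) : is_ideal I -> is_ideal (f @^-1` I).
Proof.
by move=> [? ?]; split; [exact: left_ideal_preimage|exact: right_ideal_preimage].
Qed.

Lemma left_ideal_image (I : set A) : left_ideal I -> left_ideal (f @` I).
Proof.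
move=> [I0 IB IM]; split=> [|_ _ [x Ix <-] [y Iy <-]|b _ [x Ix <-]].
- by exists 0; rewrite ?rmorph0.
- by exists (x - y); [exact: IB|rewrite rmorphB].
- by have [a <-] := f_surj b; exists (a * x); [exact: IM|rewrite rmorphM].
Qed.

Lemma right_ideal_image (I : set A) : right_ideal I -> right_ideal (f @` I).
Proof.
move=> [I0 IB IM]; split=> [|_ _ [x Ix <-] [y Iy <-]|b _ [x Ix <-]].
- by exists 0; rewrite ?rmorph0.
- by exists (x - y); [exact: IB|rewrite rmorphB].
- by have [a <-] := f_surj b; exists (x * a); [exact: IM|rewrite rmorphM].
Qed.

Lemma preimage_surj_inj (I J : set B) : f @^-1` I `<=` f @^-1` J -> I `<=` J.
Proof. by move=> IJ y; have [x <-] := f_surj y; exact: IJ. Qed.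

Lemma left_artinian_surj : left_artinian A -> left_artinian B.
Proof.
move=> artA I lI Idec; have [n|n x /Idec//|n nP] := artA (fun n => f @^-1` I n).
  exact: left_ideal_preimage.
exists n => m nm; apply/seteqP; split; apply: preimage_surj_inj.
  by rewrite nP.
by rewrite nP.
Qed.

Lemma right_artinian_surj : right_artinian A -> right_artinian B.
Proof.
move=> artA I lI Idec; have [n|n x /Idec//|n nP] := artA (fun n => f @^-1` I n).
  exact: right_ideal_preimage.
exists n => m nm; apply/seteqP; split; apply: preimage_surj_inj.
  by rewrite nP.
by rewrite nP.
Qed.

Lemma right_artinian_dcc_above :
  right_artinian B -> right_dcc_above [set x | f x = 0].
Proof.
move=> artB I rI kI Idec; have [n|n _ [x Ix <-]|n nP] := artB (fun n => f @` I n).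
- exact: right_ideal_image.
- by exists x => //; exact: Idec.
exists n => m nm x Ix.
have : (f @` I m) (f x) by rewrite nP //; exists x.
move=> [y Iy fyx]; rewrite -(subrK y x); apply: (right_idealD (rI m)) => //.
by apply: kI; rewrite /= rmorphB fyx subrr.
Qed.

Lemma dcc_above_right_artinian :
  right_dcc_above [set x | f x = 0] -> right_artinian B.
Proof.
move=> dccK I rI Idec; have IS := chain_sub Idec.
have [n|n x /= ->|n x /Idec//|n nP] := dccK (fun n => f @^-1` I n).
- exact: right_ideal_preimage.
- by case: (rI n).
exists n => m nm; apply/seteqP; split; first exact: IS.
by apply: preimage_surj_inj; exact: nP.
Qed.

Lemma semisimple_surj : semisimple_ring A -> semisimple_ring B.
Proof.
move=> ssA I lI; have [K lK [IK0 IKA]] := ssA _ (left_ideal_preimage lI).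
exists (f @` K); first exact: left_ideal_image.
split=> [|y].
  apply/seteqP; split=> [y [Iy [k Kk fk]]|_ ->] /=.
    have : (f @^-1` I `&` K) k by split=> //=; rewrite fk.
    by rewrite IK0 -fk => ->; rewrite rmorph0.
  by split; [case: lI|exists 0; [case: lK|rewrite rmorph0]].
have [x <-] := f_surj y; have [a [b [Ia Kb ->]]] := IKA x.
by exists (f a), (f b); split=> //; rewrite rmorphD.
Qed.

End Surjections.

(* Both rings are the quotient of C by the common kernel of f and g. *)
Lemma common_kernel_iso (A B C : pzRingType) (f : {rmorphism C -> A})
    (g : {rmorphism C -> B}) :
  (forall y, exists x, f x = y) -> (forall y, exists x, g x = y) ->
  (forall x, f x = 0 <-> g x = 0) -> ring_iso A B.
Proof.
move=> /choice[s sK] /choice[t tK] fg.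
have fgE x y : f x = f y <-> g x = g y.
  split=> /eqP; rewrite -subr_eq0 -rmorphB => /eqP/fg/eqP;
    by rewrite rmorphB subr_eq0 => /eqP.
pose h y := g (s y).
have hf x : h (f x) = g x by apply/fgE.
have hB : zmod_morphism h.
  by move=> x y; rewrite -[x]sK -[y]sK -rmorphB !hf rmorphB.
have hM : monoid_morphism h.
  split=> [|x y]; first by rewrite -(rmorph1 f) hf rmorph1.
  by rewrite -[x]sK -[y]sK -rmorphM !hf rmorphM.
pose H : {rmorphism A -> B} := HB.pack h
  (GRing.isZmodMorphism.Build A B h hB) (GRing.isMonoidMorphism.Build A B h hM).
exists H; exists (fun y => f (t y)) => [x|y].
  by rewrite -[RHS]sK; apply/fgE; rewrite tK.
by rewrite /= hf.
Qed.

(** If L omits x, then 1 = a + r x with a in L; since r x is nilpotent, a = 1 - r x is left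
    invertible. *)
Lemma nil_sub_jacobson (R : pzRingType) (I : set R) :
  nil_ideal I -> I `<=` jacobson R.
Proof.
move=> [[[_ _ Il] _] nilI] x Ix L mL; apply: contrapT => nLx.
have [a [_ [La [r ->] arx]]] := maximal_left_ideal_comax mL
  (principal_left_ideal x) (fun H => nLx (H x (ex_intro _ 1 (esym (mul1r x))))).
have [n /nilpotent_left_inverse[y yE]] := nilI _ (Il r _ Ix).
apply: (maximal_left_ideal_proper mL); rewrite -yE arx addrK.
by have [[_ _ Ll] _ _] := mL; exact: Ll.
Qed.

(** Annihilators modulo P avoid the ideals generated by a and b: B collects the y with a R y in P, A
    the x with x R B in P. Then a is in A, b is in B and A B lies in P. *)
Lemma prime_idealP (R : pzRingType) (P : set R) a b : prime_ideal P ->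
  (forall r, P (a * r * b)) -> P a \/ P b.
Proof.
move=> [[[P0 PB Pl] [_ _ Pr]] _ primeP] Pab.
pose B := [set y | forall r, P (a * r * y)].
pose A := [set x | forall r y, B y -> P (x * r * y)].
have iB : is_ideal B.
  split; split=> [r|x y Bx By r|s x Bx r]; rewrite ?mulr0 //.
  - by rewrite mulrBr; exact: PB.
  - by rewrite mulrA -(mulrA a); exact: Bx.
  - by rewrite mulrBr; exact: PB.
  - by rewrite mulrA; exact: Pr.
have iA : is_ideal A.
  split; split=> [r z Bz|x y Ax Ay r z Bz|s x Ax r z Bz]; rewrite ?mul0r //.
  - by rewrite !mulrBl; apply: PB; [exact: Ax|exact: Ay].
  - by rewrite -!mulrA; apply: (Pl); rewrite mulrA; exact: Ax.
  - by rewrite !mulrBl; apply: PB; [exact: Ax|exact: Ay].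
  - by rewrite -(mulrA x); exact: Ax.
have [|AP|BP] := primeP A B iA iB; last by right; apply: BP.
  apply: ideal_mul_sub => // [x y Px Py|x y Ax By].
    by rewrite -[y]opprK -[- y]sub0r; apply: (PB) => //; exact: PB.
  by have := Ax 1 y By; rewrite mulr1.
by left; apply: AP => r y; exact.
Qed.

(** * Quotients by maximal ideals and by the radical *)

Section Quotients.
Variables (R : pzRingType) (I : ideal R).

Lemma quotient_pi_surj (y : quotient_ring I) : exists x, quotient_pi I x = y.
Proof. by exists (repr y); exact: reprK. Qed.

Lemma quotient_pi_eq0 x : quotient_pi I x = 0 <-> ideal_set I x.
Proof. by rewrite -(rmorph0 (quotient_pi I)) quotient_piP subr0. Qed.

Lemma quotient_pi_kernel : [set x | quotient_pi I x = 0] = I.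
Proof. by apply/seteqP; split=> x /quotient_pi_eq0. Qed.

Lemma quotient_left_artinian : left_artinian R -> left_artinian (quotient_ring I).
Proof. exact: left_artinian_surj quotient_pi_surj. Qed.

Lemma simple_quotient : maximal_ideal I -> simple_ring (quotient_ring I).
Proof.
move=> mI; split=> [pi1|K iK].
  by apply: (maximal_ideal_proper mI); apply/quotient_pi_eq0.
pose L := quotient_pi I @^-1` K.
have iL : is_ideal L by exact: is_ideal_preimage.
have IL : I `<=` L by move=> x /quotient_pi_eq0 /= Ix; rewrite /L /= Ix; case: iK => -[].
have [LI|nLI] := pselect (L `<=` I); [left|right].
  apply/seteqP; split=> [y|_ ->]; last by case: iK => -[].
  by have [x <-] := quotient_pi_surj y => /LI/quotient_pi_eq0.
apply/seteqP; split=> // y _; have [x <-] := quotient_pi_surj y.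
suff : L x by [].
by rewrite (maximal_idealE mI iL IL nLI).
Qed.

End Quotients.

Section ArtinianQuotients.
Variable T : pzRingType.
Hypothesis artT : left_artinian T.

Lemma simple_quotient_artinian (M : ideal T) :
  maximal_ideal M -> artinian (quotient_ring M).
Proof.
move=> mM; have artM := quotient_left_artinian (I := M) artT.
by split=> //; apply: simple_right_artinian => //; exact: simple_quotient.
Qed.

(** For the right side, J(T) is a finite intersection of maximal ideals M, each with T/M right
    Artinian. *)
Lemma jacobson_quotient_artinian : artinian (quotient_ring (Jacobson T)).
Proof.
split; first exact: quotient_left_artinian.
apply: (dcc_above_right_artinian (@quotient_pi_surj _ (Jacobson T))).
rewrite quotient_pi_kernel /=; have [s sE] := finite_maximal_ideals artT.
rewrite (jacobson_meet_ideals artT sE).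
have {sE} : forall M, M \in s -> maximal_ideal M by move=> M /sE.
elim: s => [|M s IHs] ms.
  by move=> I _ IT _; exists 0%N => m _ x _; apply: IT => M; rewrite in_nil.
have mM : maximal_ideal M by apply: ms; rewrite mem_head.
have ms' N : N \in s -> maximal_ideal N by move=> sN; apply: ms; rewrite inE sN orbT.
have [iM _ _] := mM; rewrite meet_ideals_cons; apply: right_dcc_aboveI.
- by case: iM.
- by apply: (meet_ideals_is_ideal _).2 => N /ms'[].
- have [_ artM] := simple_quotient_artinian (M := Ideal iM) mM.
  by have := right_artinian_dcc_above (@quotient_pi_surj _ _) artM;
    rewrite quotient_pi_kernel.
- exact: IHs.
Qed.

Lemma jacobson_quotient_semisimple : semisimple_ring (quotient_ring (Jacobson T)).
Proof.
move=> I lI; pose pi := quotient_pi (Jacobson T).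
have lL : left_ideal (pi @^-1` I) by exact: left_ideal_preimage.
have JL : jacobson T `<=` pi @^-1` I.
  by move=> x /(quotient_pi_eq0 (Jacobson T)) xE; rewrite /pi /= xE; case: lI.
have [K lK [JK LKJ LKT]] := jacobson_complement artT lL JL.
exists (pi @` K); first exact: left_ideal_image (@quotient_pi_surj _ _) _ lK.
split=> [|y].
  apply/seteqP; split=> [y [Iy [k Kk fk]]|_ ->] /=.
    by rewrite -fk; apply/quotient_pi_eq0; apply: LKJ; split=> //=; rewrite fk.
  by split; [case: lI|exists 0; [case: lK|rewrite /pi rmorph0]].
have [x <-] := quotient_pi_surj y.
have : ideal_add (pi @^-1` I) K x by rewrite LKT.
by move=> [a [b [Ia Kb ->]]]; exists (pi a), (pi b);
  rewrite -rmorphD; split=> //; exists b.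
Qed.

End ArtinianQuotients.

(** * Passing between ideals of T and ideals of the subring R *)

Section Subrings.
Variables (T : pzRingType) (R : subring T).
Local Notation R_ := (subring_ring R).

Lemma subring_val_inj (x y : R_) : val x = val y -> x = y.
Proof. exact: val_inj. Qed.

Lemma subring_valM (x y : R_) : val (x * y) = val x * val y.
Proof. exact: rmorphM. Qed.

Lemma subring_valD (x y : R_) : val (x + y) = val x + val y.
Proof. exact: rmorphD. Qed.

Lemma subring_valB (x y : R_) : val (x - y) = val x - val y.
Proof. exact: rmorphB. Qed.

Lemma subring_val1 : val (1 : R_) = 1.
Proof. exact: rmorph1. Qed.

Lemma subring_val0 : val (0 : R_) = 0.
Proof. exact: rmorph0. Qed.

Lemma subring_lift t : subring_set R t -> exists x : R_, val x = t.
Proof. by move=> /mem_set Rt; exists (exist _ t Rt). Qed.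

Lemma trace_is_ideal A : is_ideal A -> is_ideal (trace R A).
Proof. exact: is_ideal_preimage. Qed.

(** The conductor is an ideal of T above M, and it is proper because R is. Since it depends on R
    alone, this also yields the uniqueness of M. *)
Lemma conductor_maximal M : maximal_subring R -> maximal_ideal M -> M `<=` R ->
  conductor R = M.
Proof.
move=> [[R1 RB RM] [_ nTR] _] mM MR; have [iM _ _] := mM.
have [[M0 MB Ml] [_ _ Mr]] := iM.
have MC : M `<=` conductor R.
  by move=> x Mx s t; apply: MR; apply: Mr; exact: Ml.
have CR x : conductor R x -> subring_set R x by move=> /(_ 1 1); rewrite mul1r mulr1.
have iC : is_ideal (conductor R).
  split; split=> [s t|x y Cx Cy s t|a x Cx s t]; rewrite ?mulr0 ?mul0r //.
  - by rewrite -(subrr 1); exact: RB.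
  - by rewrite mulrBr mulrBl; exact: RB.
  - by rewrite mulrA; exact: Cx.
  - by rewrite -(subrr 1); exact: RB.
  - by rewrite mulrBr mulrBl; exact: RB.
  - by rewrite mulrA -mulrA; exact: Cx.
apply/seteqP; split=> //; apply: contrapT => nCM.
apply: nTR => x _; apply: CR.
by rewrite (maximal_idealE mM iC MC nCM).
Qed.

Lemma quotient_maximal_subring (M : ideal T) : maximal_subring R -> M `<=` R ->
  maximal_subring (quotient_pi M @` R).
Proof.
move=> [[R1 RB RM] [_ nTR] maxR] MR.
have piR x : (quotient_pi M @` R) (quotient_pi M x) -> subring_set R x.
  move=> [y Ry /quotient_piP Myx].
  have -> : x = y - (y - x) by rewrite opprB addrC subrK.
  by apply: RB => //; exact: MR.
split.
- split; first by exists 1 => //; exact: rmorph1.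
    by move=> _ _ [x Rx <-] [y Ry <-]; exists (x - y); [exact: RB|rewrite rmorphB].
  by move=> _ _ [x Rx <-] [y Ry <-]; exists (x * y); [exact: RM|rewrite rmorphM].
- split=> // TR; apply: nTR => x _; apply: piR; exact: TR.
move=> S [S1 SB SM] [[RS nSR] [_ nTS]].
apply: (maxR (quotient_pi M @^-1` S)).
  split=> [|x y Sx Sy|x y Sx Sy]; rewrite /= ?rmorph1 ?rmorphB ?rmorphM //.
    exact: SB.
  exact: SM.
split; split=> //.
- by move=> x Rx; apply: RS; exists x.
- move=> SR; apply: nSR => y Sy; have [x xy] := quotient_pi_surj y.
  by exists x => //; apply: SR; rewrite /= xy.
by move=> TS; apply: nTS => y _; have [x <-] := quotient_pi_surj y; exact: TS.
Qed.

(** The t with M t M inside I. As I consists of elements of the type [subring_ring R], membership of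
    m t m' is expressed by a preimage under [val]. *)
Definition ideal_lift (M : set T) (I : set R_) : set T :=
  [set t | forall m m', M m -> M m' -> exists2 z, I z & val z = m * t * m'].

Lemma ideal_lift_is_ideal (M : set T) (I : set R_) :
  is_ideal M -> is_ideal I -> is_ideal (ideal_lift M I).
Proof.
move=> [[M0 MB Ml] [_ _ Mr]] [[I0 IB Il] [_ _ Ir]].
have L0 : ideal_lift M I 0
  by move=> m m' _ _; exists 0; rewrite ?mulr0 ?mul0r ?subring_val0.
have LB x y : ideal_lift M I x -> ideal_lift M I y -> ideal_lift M I (x - y).
  move=> Lx Ly m m' Mm Mm'; have [z Iz zE] := Lx m m' Mm Mm'.
  have [w Iw wE] := Ly m m' Mm Mm'; exists (z - w); first exact: IB.
  by rewrite subring_valB mulrBr mulrBl -zE -wE.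
split; split=> // a x Lx m m' Mm Mm'.
  by have [|//|z Iz zE] := Lx (m * a) m'; [exact: Mr|exists z; rewrite ?zE ?mulrA].
by have [//||z Iz zE] := Lx m (a * m'); [exact: Ml|exists z; rewrite ?zE ?mulrA].
Qed.

(* A prime P of R not containing M is R & P' for the prime P' = {t | M t M <= P}
   of T; as P' is maximal, P' + M = T. *)
Lemma prime_sub_maximal (M : set T) (P : set R_) : left_artinian T ->
  maximal_ideal M -> M `<=` R -> prime_ideal P ->
  trace R M `<=` P \/ maximal_ideal P.
Proof.
move=> artT mM MR pP; have [iM _ _] := mM; have [iP _ _] := pP.
have [[_ _ Ml] [_ _ Mr]] := iM; have [[_ PB Pl] [_ _ Pr]] := iP.
have [|/nonsubset[m0 [Mm0 nPm0]]] := pselect (trace R M `<=` P); [by left|right].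
have iL := ideal_lift_is_ideal iM iP.
(* If M x M lies in P, then so does m0 R x R m0; primality, used twice with m0 outside P, leaves x
   in P. *)
have LP (x : R_) : ideal_lift M P (val x) -> P x.
  move=> Lx; have [r|//|//] := prime_idealP (a := m0) (b := x) pP.
  have [s|//|//] := prime_idealP (a := m0 * r * x) (b := m0) pP.
  have [||z Pz zE] := Lx (val (m0 * r)) (val (s * m0)).
  - by rewrite subring_valM; exact: Mr.
  - by rewrite subring_valM; exact: Ml.
  suff <- : z = m0 * r * x * s * m0 by [].
  by apply: subring_val_inj; rewrite zE -!subring_valM !mulrA.
have pL : prime_ideal (ideal_lift M P).
  split=> //.
    split=> // TL; apply: nPm0; apply: LP; exact: TL.
  move=> I J iI iJ IJL; apply: contrapT => /not_orP[/nonsubset[a [Ia nLa]]].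
  move=> /nonsubset[b [Jb nLb]].
  (* For a and b outside the lift, take z = m a m' and w = n b n' outside P. Each z r w is m (a (m'
     r n) b) n', where the middle product lies in I J and so in the lift; hence z R w lies in P, a
     contradiction. *)
  have wit t : ~ ideal_lift M P t -> exists m m' z,
      [/\ M m, M m', val z = m * t * m' & ~ P z].
    move=> nLt; apply: contrapT => nowit; apply: nLt => m m' Mm Mm'.
    have [|z zE] := @subring_lift (m * t * m').
      by apply: MR; rewrite -mulrA; exact: Mr.
    by exists z => //; apply: contrapT => nPz; apply: nowit; exists m, m', z.
  have [m [m' [z [Mm Mm' zE nPz]]]] := wit _ nLa.
  have [n [n' [w [Mn Mn' wE nPw]]]] := wit _ nLb.
  have [r|//|//] := prime_idealP (a := z) (b := w) pP.
  have : ideal_lift M P (a * (m' * val r * n) * b).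
    apply: IJL; apply: ideal_mul1 => //.
    by have [_ [_ _]] := iI; apply.
  move=> /(_ m n' Mm Mn')[v Pv vE]; suff <- : v = z * r * w by [].
  by apply: subring_val_inj; rewrite vE !subring_valM zE wE !mulrA.
have mL := left_artinian_prime_maximal artT pL.
have nML : ~ M `<=` ideal_lift M P.
  by move=> ML; apply: nPm0; apply: LP; exact: ML.
have [p [m [Lp Mm pm]]] := maximal_ideal_comax mL iM nML.
have [m_ mE] := subring_lift (MR _ Mm).
have Pp : P (1 - m_) by apply: LP; rewrite subring_valB subring_val1 mE pm addrK.
apply: maximal_ideal_intro => // [P1|I iI PI /nonsubset[x [Ix nPx]]].
  by case: pP => _ [_ +] _; apply; rewrite (left_ideal1 iP.1 P1).
have [[_ IB Il] [_ _ Ir]] := iI; have ID := left_idealD iI.1.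
have iLI := ideal_lift_is_ideal iM iI.
have : ideal_lift M I 1.
  rewrite (maximal_idealE mL iLI) //.
    move=> t Lt n n' Mn Mn'; have [z Pz zE] := Lt n n' Mn Mn'.
    by exists z => //; exact: PI.
  move=> LIL; apply: nPx; apply: LP; apply: LIL => n n' Mn Mn'.
  have [n_ <-] := subring_lift (MR _ Mn); have [n'_ <-] := subring_lift (MR _ Mn').
  by exists (n_ * x * n'_); rewrite ?subring_valM //; apply: (Ir); exact: Il.
(* As 1 is in the lift of I, m m lies in I; and 1 - m m = (1 - m) (1 + m) lies in P because 1 - m
   does. *)
move=> /(_ m m Mm Mm)[z Iz]; rewrite mulr1 -mE -subring_valM => /subring_val_inj zE.
have -> : 1 = (1 - m_) * (1 + m_) + z :> R_.
  by rewrite zE mulrDr mulr1 mulrBl mul1r addrA subrK subrK.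
by apply: ID => //; apply: (Ir); exact: PI.
Qed.

(** R + M is a subring strictly above R. In this form the conclusion says that R maps onto T/M,
    which is all that is retained of the maximality of R in the second case. *)
Lemma maximal_subring_add M : maximal_subring R -> is_ideal M -> ~ M `<=` R ->
  forall t, exists r : R_, M (t - val r).
Proof.
move=> [[R1 RB RM] _ maxR] iM nMR t.
have [[M0 MB Ml] [_ _ Mr]] := iM; have MD := left_idealD iM.1.
have R0 : subring_set R 0 by rewrite -(subrr 1); exact: RB.
have sub : is_subring (ideal_add R M).
  split; first by exists 1, 0; rewrite addr0.
    move=> _ _ [a [b [Ra Mb ->]]] [c [d [Rc Md ->]]].
    by exists (a - c), (b - d); rewrite opprD addrACA; split=> //;
      [exact: RB|exact: MB].
  move=> _ _ [a [b [Ra Mb ->]]] [c [d [Rc Md ->]]].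
  exists (a * c), (a * d + b * (c + d)).
  split; [exact: RM|by apply: MD; [exact: Ml|exact: Mr]|].
  by rewrite mulrDl mulrDr addrA.
have : ideal_add R M t.
  apply: contrapT => nt; apply: (maxR _ sub); split; last by split=> // /(_ t I).
  split=> [x Rx|RMR]; first by exists x, 0; rewrite addr0.
  by apply: nMR => x Mx; apply: RMR; exists 0, x; rewrite add0r.
move=> [r [m [Rr Mm ->]]]; have [r_ rE] := subring_lift Rr.
by exists r_; rewrite rE addrAC subrr add0r.
Qed.

(** For an ideal I of R above the trace, K = I + M is an ideal of T, because any element of T may be
    replaced by one of R modulo M. If I is larger than the trace, K is larger than M, so it contains
    1. *)
Lemma trace_maximal M : maximal_ideal M ->
  (forall t, exists r : R_, M (t - val r)) -> maximal_ideal (trace R M).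
Proof.
move=> mM MR; have [iM _ _] := mM; have [[M0 MB Ml] [_ _ Mr]] := iM.
have MD := left_idealD iM.1.
apply: maximal_ideal_intro; first exact: trace_is_ideal.
  by have := maximal_ideal_proper mM; rewrite -subring_val1.
move=> I iI MI /nonsubset[x [Ix nMx]].
have [[I0 IB Il] [_ _ Ir]] := iI; have ID := left_idealD iI.1.
pose K := [set t | exists2 z, I z & M (t - val z)].
have iK : is_ideal K.
  split; split; try by exists 0; rewrite // subring_val0 subr0.
  - move=> s t [z Iz Mz] [w Iw Mw]; exists (z - w); first exact: IB.
    have -> : s - t - val (z - w) = s - val z - (t - val w).
      by rewrite subring_valB !opprD addrACA.
    exact: MB.
  - move=> s t [z Iz Mz]; have [r Mr'] := MR s; exists (r * z); first exact: Il.
    have -> : s * t - val (r * z) = s * (t - val z) + (s - val r) * val z.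
      by rewrite subring_valM mulrBr mulrBl addrA subrK.
    by apply: MD; [exact: Ml|exact: Mr].
  - move=> s t [z Iz Mz] [w Iw Mw]; exists (z - w); first exact: IB.
    have -> : s - t - val (z - w) = s - val z - (t - val w).
      by rewrite subring_valB !opprD addrACA.
    exact: MB.
  - move=> s t [z Iz Mz]; have [r Mr'] := MR s; exists (z * r); first exact: Ir.
    have -> : t * s - val (z * r) = (t - val z) * s + val z * (s - val r).
      by rewrite subring_valM mulrBr mulrBl addrA subrK.
    by apply: MD; [exact: Mr|exact: Ml].
have : K 1.
  rewrite (maximal_idealE mM iK) //.
    by move=> m Mm; exists 0; rewrite // subring_val0 subr0.
  by move=> KM; apply: nMx; apply: KM; exists x; rewrite // subrr.
move=> [z Iz Mz]; rewrite -(subrK z 1); apply: ID => //; apply: MI.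
by change (M (val (1 - z))); rewrite subring_valB subring_val1.
Qed.

Lemma trace_nilpotent A : nilpotent_ideal A -> nilpotent_ideal (trace R A).
Proof.
move=> [iA [n An]]; split; first exact: trace_is_ideal.
exists n; apply/seteqP; split=> [|_ ->]; last first.
  by case: (ideal_pow_is_ideal n (trace_is_ideal iA)) => -[].
suff sub : ideal_pow (trace R A) n `<=` trace R (ideal_pow A n).
  by move=> x /sub; rewrite An => x0; apply: subring_val_inj; rewrite subring_val0.
elim: n {An} => [//|n IHn]; have iS := trace_is_ideal (ideal_pow_is_ideal n.+1 iA).
apply: ideal_mul_sub; [by case: iS => -[]|exact: left_idealD iS.1|].
move=> x y Ax /IHn Ay; change (ideal_pow A n.+1 (val (x * y))).
by rewrite subring_valM; exact: ideal_mul1.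
Qed.

End Subrings.

(** * Subrings R with R + M = T for every maximal ideal M of T *)

Section NoMaximalIdealInside.
Variables (T : pzRingType) (R : subring T).
Local Notation R_ := (subring_ring R).
Hypothesis artT : left_artinian T.
Hypothesis T_neq0 : (1 : T) <> 0.
Hypothesis supp : forall M, maximal_ideal M ->
  forall t, exists r : R_, M (t - val r).

Lemma trace_jacobson_meet (x : R_) :
  (forall M, maximal_ideal M -> trace R M x) -> trace R (jacobson T) x.
Proof. by move=> Mx; rewrite /trace /= jacobsonE // => M /Mx. Qed.

Lemma prime_traceP (P : set R_) : prime_ideal P <->
  exists2 M, maximal_ideal M & P = trace R M.
Proof.
split=> [pP|[M mM ->]]; last first.
  by apply: maximal_ideal_prime; apply: trace_maximal => //; exact: supp.
have [s sE] := finite_maximal_ideals artT.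
have NP := nilpotent_sub_prime (trace_nilpotent R (jacobson_nilpotent artT)) pP.
have [|x sx|Q /mapP[M /sE mM ->] MP] :=
    @prime_meet_ideals _ P [seq trace R M | M <- s] pP.
- by move=> Q /mapP[M /sE[iM _ _] ->]; exact: trace_is_ideal.
- by apply: NP; apply: trace_jacobson_meet => M /sE sM; apply: sx; exact: map_f.
exists M => //; have mR := trace_maximal mM (supp mM).
have [iP [_ nTP] _] := pP; apply/seteqP; split=> //; apply: contrapT => nPM.
by apply: nTP; rewrite (maximal_idealE mR iP MP nPM).
Qed.

Lemma prime_trace_maximal (P : set R_) : prime_ideal P -> maximal_ideal P.
Proof. by move=> /prime_traceP[M mM ->]; apply: trace_maximal => //; exact: supp. Qed.

(** [T_neq0] supplies a maximal ideal of T, whose trace is the one prime that a chain of length 0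
    needs. *)
Lemma subring_zero_dimensional : zero_dimensional R_.
Proof.
have [M mM] := exists_maximal_ideal artT T_neq0.
split; first by exists (fun=> trace R M); split=> // _ _; apply/prime_traceP; exists M.
move=> [//|n] P [primeP ltP].
have m0 := prime_trace_maximal (primeP 0%N isT).
have [i1 [_ nT1] _] := primeP 1%N isT.
by have [P01 nP10] := ltP 0%N isT; case: nT1; rewrite (maximal_idealE m0 i1 P01 nP10).
Qed.

(** As an image of Max T, the spectrum inherits finiteness and the cardinality bound. *)
Lemma SpecE : Spec R_ = trace R @` Max T.
Proof.
apply/seteqP; split=> [P /prime_traceP[M mM ->]|_ [M mM <-]]; first by exists M.
by apply/prime_traceP; exists M.
Qed.

Lemma finite_Max : finite_set (Max T).
Proof.
have [s sE] := finite_maximal_ideals artT; apply/finite_seqP; exists s.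
by apply/seteqP; split=> M /sE.
Qed.

(** The inclusions close a circle: the trace of J(T) is nilpotent, hence nil; nil ideals lie in
    J(R); and J(R) lies in all traces of maximal ideals, since these are maximal in R. *)
Lemma subring_radicals :
  [/\ jacobson R_ = upper_nilradical R_,
      upper_nilradical R_ = lower_nilradical R_,
      lower_nilradical R_ = trace R (jacobson T) & nilpotent_ideal (jacobson R_)].
Proof.
have nilN := trace_nilpotent R (jacobson_nilpotent artT).
have LN : lower_nilradical R_ = trace R (jacobson T).
  apply/seteqP; split=> [x Lx|x Nx P pP]; last exact: nilpotent_sub_prime Nx.
  by apply: trace_jacobson_meet => M mM; apply: Lx; apply/prime_traceP; exists M.
have NU : trace R (jacobson T) `<=` upper_nilradical R_.
  by move=> x Nx; exists (trace R (jacobson T)) => //; exact: nilpotent_is_nil.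
have UJ : upper_nilradical R_ `<=` jacobson R_.
  by move=> x [I nI Ix]; exact: nil_sub_jacobson Ix.
have JN : jacobson R_ `<=` trace R (jacobson T).
  move=> x Jx; apply: trace_jacobson_meet => M mM.
  by apply: jacobson_sub_maximal Jx; apply: trace_maximal => //; exact: supp.
have JE : jacobson R_ = trace R (jacobson T).
  by apply/seteqP; split=> // x /NU/UJ.
have UE : upper_nilradical R_ = trace R (jacobson T).
  by apply/seteqP; split=> // x /UJ/JN.
by rewrite LN UE JE.
Qed.

(** R maps onto both T/M and T/N, with the two traces as kernels. *)
Lemma equal_traces_iso (M N : ideal T) : maximal_ideal M -> maximal_ideal N ->
  trace R M = trace R N -> ring_iso (quotient_ring M) (quotient_ring N).
Proof.
move=> mM mN MN.
have surj (K : ideal T) : maximal_ideal K ->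
    forall y, exists x : R_, (quotient_pi K \o val) x = y.
  move=> mK y; have [t <-] := quotient_pi_surj y; have [r Kr] := supp mK t.
  by exists r; apply/esym/quotient_piP.
apply: (common_kernel_iso (C := R_) (f := quotient_pi M \o val)
  (g := quotient_pi N \o val)) => [||x]; [exact: surj|exact: surj|].
have := congr1 (fun A => A x) MN; rewrite /trace /= => MNx.
by rewrite !quotient_pi_eq0 MNx.
Qed.

(* Chinese remainder theorem in R, the traces of the maximal ideals being
   pairwise distinct maximal ideals of R. *)
Lemma distinct_traces_jacobson :
  (forall M N, maximal_ideal M -> maximal_ideal N ->
     trace R M = trace R N -> M = N) ->
  forall t, exists r : R_, jacobson T (t - val r).
Proof.
move=> inj t; have [s sE] := finite_maximal_ideals artT.
suff [r rE] : exists r : R_, forall M, M \in s -> M (t - val r).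
  by exists r; rewrite jacobsonE // => M /sE; exact: rE.
have {sE} : forall M, M \in s -> maximal_ideal M by move=> M /sE.
elim: s => [|M s IHs] ms; first by exists 0.
have mM : maximal_ideal M by apply: ms; rewrite mem_head.
have ms' N : N \in s -> maximal_ideal N by move=> sN; apply: ms; rewrite inE sN orbT.
have [r rE] := IHs ms'.
have [sM|nsM] := boolP (M \in s).
  by exists r => N; rewrite inE => /predU1P[->|]; exact: rE.
have mR := trace_maximal mM (supp mM).
pose tr := [seq trace R N | N <- s].
have itr Q : Q \in tr -> is_ideal Q.
  by move=> /mapP[N /ms'[iN _ _] ->]; exact: trace_is_ideal.
(* Otherwise the trace of M contains, hence equals, that of some N in s, and injectivity puts M in
   s. *)
have nMtr : ~ meet_ideals tr `<=` trace R M.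
  move=> /(prime_meet_ideals (maximal_ideal_prime mR) itr)[_ /mapP[N sN ->] NM].
  have mN := ms' _ sN; have mNR := trace_maximal mN (supp mN).
  by move: nsM; rewrite -(inj N M mN mM (maximal_ideal_eq mNR mR NM)) sN.
have [a [b [Ma trb ab]]] := maximal_ideal_comax mR (meet_ideals_is_ideal itr) nMtr.
(* Here r solves the problem for the ideals of s and q solves it for M. The element b is 1 modulo M
   and 0 modulo each ideal of s. *)
have [q Mq] := supp mM t; exists (r + (q - r) * b) => N.
have -> : t - val (r + (q - r) * b) = t - val r - val (q - r) * val b.
  by rewrite subring_valD subring_valM opprD addrA.
rewrite inE => /predU1P[->|sN].
  have [[lM _] _ _] := mM; have [_ _ Ml] := lM; have MD := left_idealD lM.
  have -> : t - val r - val (q - r) * val b = (t - val q) + val (q - r) * val a.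
    have -> : val b = 1 - val a.
      by rewrite -(subring_val1 R) ab subring_valD addrAC subrr add0r.
    rewrite mulrBr mulr1 {1}subring_valB opprB (opprB (val q)) addrCA.
    by rewrite [X in _ + X]addrA subrK addrC.
  by apply: MD => //; exact: Ml.
have [[[_ NB Nl] _] _ _] := ms' _ sN; apply: NB; first exact: rE.
by apply: Nl; apply: (trb (trace R N)); exact: map_f.
Qed.

Lemma distinct_traces_iso :
  (forall M N, maximal_ideal M -> maximal_ideal N ->
     trace R M = trace R N -> M = N) ->
  ring_iso (quotient_ring (Jacobson R_)) (quotient_ring (Jacobson T)) /\
  semiprimary R_.
Proof.
move=> inj; have [JU UL LN nilJ] := subring_radicals.
have surj y : exists x : R_, (quotient_pi (Jacobson T) \o val) x = y.
  have [t <-] := quotient_pi_surj y; have [r Jr] := distinct_traces_jacobson inj t.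
  by exists r; apply/esym/quotient_piP.
have ker (x : R_) : quotient_pi (Jacobson R_) x = 0 <->
    (quotient_pi (Jacobson T) \o val) x = 0.
  by rewrite /= !quotient_pi_eq0 /= JU UL LN.
have iso := common_kernel_iso (C := R_) (f := quotient_pi (Jacobson R_))
  (g := quotient_pi (Jacobson T) \o val) (@quotient_pi_surj _ _) surj ker.
(* The isomorphism is needed in this direction too, as the ring properties travel along a surjection
   from T/J(T). *)
have [f [g _ gK]] : ring_iso (quotient_ring (Jacobson T)) (quotient_ring (Jacobson R_)).
  by apply: (common_kernel_iso (C := R_) (g := quotient_pi (Jacobson R_))
    (f := quotient_pi (Jacobson T) \o val)) => [||x];
    [exact: surj|exact: quotient_pi_surj|exact: iff_sym (ker x)].
have f_surj y : exists x, f x = y by exists (g y).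
split=> //; split=> //.
  exact: semisimple_surj f_surj (jacobson_quotient_semisimple artT).
have [artl artr] := jacobson_quotient_artinian artT.
by split; [exact: left_artinian_surj f_surj artl|exact: right_artinian_surj f_surj artr].
Qed.

End NoMaximalIdealInside.

(* The two cases are separated by whether R contains a maximal ideal of T;
   without this clause the second alternative could hold together with the
   first. *)
Theorem theorem3p18 (T : pzRingType) (R : subring T) :
  left_artinian T -> maximal_subring R ->
  exactly_one
    (exists M : ideal T,
      [/\ maximal_ideal M /\ M `<=` R,
          forall N : set T, maximal_ideal N -> N `<=` R -> N = M,
          [/\ maximal_subring (quotient_pi M @` R),
              simple_ring (quotient_ring M),
              artinian (quotient_ring M)
            & exists (n : nat) (D : unitRingType),
                [/\ (0 < n)%N, division_ring D
                  & ring_iso (quotient_ring M) 'M[D]_n]],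
          conductor R = M
        & forall P : set (subring_ring R), prime_ideal P ->
            trace R (conductor R) `<=` P \/ maximal_ideal P])
    ((~ exists M : set T, maximal_ideal M /\ M `<=` R) /\
     [/\ zero_dimensional (subring_ring R),
         finite_set (Spec (subring_ring R)) /\
           (Spec (subring_ring R) #<= Max T)%card,
         [/\ jacobson (subring_ring R) = upper_nilradical (subring_ring R),
             upper_nilradical (subring_ring R)
               = lower_nilradical (subring_ring R),
             lower_nilradical (subring_ring R) = trace R (jacobson T)
           & nilpotent_ideal (jacobson (subring_ring R))]
       & (exists M N : ideal T,
            [/\ maximal_ideal M, maximal_ideal N, (M : set T) <> N
              & ring_iso (quotient_ring M) (quotient_ring N)])
         \/ (ring_iso (quotient_ring (Jacobson (subring_ring R)))
                      (quotient_ring (Jacobson T))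
             /\ semiprimary (subring_ring R))]).
Proof.
move=> artT maxR; have [[R1 RB RM] [_ nTR] _] := maxR.
(* The zero ring has no proper subring. *)
have n10 : (1 : T) <> 0.
  move=> T10; apply: nTR => x _; rewrite -[x]mul1r T10 mul0r -(subrr 1).
  exact: RB.
have [[M [mM MR]]|noM] := pselect (exists M : set T, maximal_ideal M /\ M `<=` R).
  left; split; last by move=> [noM _]; apply: noM; exists M.
  have [iM _ _] := mM; exists (Ideal iM).
  have CM := conductor_maximal maxR mM MR.
  split=> //.
  - by move=> N mN NR; rewrite -(conductor_maximal maxR mN NR) CM.
  - split.
    + exact: quotient_maximal_subring.
    + exact: simple_quotient.
    + exact: simple_quotient_artinian.
    + apply: simple_matrix_ring; first exact: simple_quotient.
      exact: quotient_left_artinian.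
  - by move=> P pP; rewrite CM; exact: prime_sub_maximal.
right; split; first by move=> [M [[mM MR] _ _ _ _]]; apply: noM; exists M.
have supp M : maximal_ideal M -> forall t, exists r : subring_ring R, M (t - val r).
  move=> mM; apply: maximal_subring_add => //; first by case: mM.
  by move=> MR; apply: noM; exists M.
split=> //; split.
- exact: subring_zero_dimensional.
- rewrite (SpecE artT supp); split; last exact: card_image_le.
  by apply: finite_image; exact: finite_Max.
- exact: subring_radicals.
(* Alternatives (a) and (b) are decided by whether the trace map is injective on Max T. *)
have [inj|ninj] := pselect (forall M N, maximal_ideal M -> maximal_ideal N ->
    trace R M = trace R N -> M = N).
  by right; exact: distinct_traces_iso.
left; apply: contrapT => noMN; apply: ninj => M N mM mN MN.
apply: contrapT => neq; apply: noMN.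
have [iM _ _] := mM; have [iN _ _] := mN; exists (Ideal iM), (Ideal iN).
by split=> //; exact: (equal_traces_iso supp).
Qed.
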